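(* Let $f$ be any real exponential $k$-sum of degree $d$ with at most one sign alternation, and let $R,\varepsilon>0$. Then, given an oracle for evaluating $x^r$ for any $x,r\in\mathbb{R}$, one can $\varepsilon$-approximate all the roots of $f$ in the interval $(0,R)$ (and count their number) using $$\mathcal{O}\left(k\left(\log d+\log\log\tfrac{R}{\varepsilon}\right)\right)$$ arithmetic operations over $\mathbb{R}$ (including oracle calls). In particular, restricting to $k$-nomials and removing the oracle, one can still do the same using $$\mathcal{O}\left(k\log d\left(\log d+\log\log\tfrac{R}{\varepsilon}\right)\right)$$ arithmetic operations over $\mathbb{R}$, where $d$ agrees with the usual degree of a univariate Laurent polynomial.
   Context: A real exponential $k$-sum is a function $f(x)=\sum_{a\in\mathcal{A}}c_a x^a$ where $\mathcal{A}\subset\mathbb{R}$ is a finite set with $k$ elements and the $c_a$ are nonzero real numbers. When $\mathcal{A}\subset\mathbb{Z}$, $f$ is called a $k$-nomial. Degree: if $\mathcal{A}\subset\mathbb{Z}$, the degree of $f$ is $\max_{a,a'\in\mathcal{A}}\{a-a'\}$. Otherwise $\deg(f):=\max\{a-a'\}/\min\{1,\min\{|a-a'|\}\}$, where the maximum is over $a,a'\in\mathcal{A}$ and the inner minimum is over all distinct $a,a'\in\mathcal{A}$; the degree of any monomial is declared to be $0$. Sign alternations: $f$ has $j$ sign alternations iff there are exactly $j$ distinct pairs $(a,a')\in\mathcal{A}^2$ with $a'>a$, no element of $\mathcal{A}$ in the open interval between $a$ and $a'$, and $c_ac_{a'}<0$. To $\varepsilon$-approximate the roots in a region means to output, for each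 root in the region, a point within distance $\varepsilon$ of it. The computational model is that of algorithms performing exact arithmetic operations on real numbers, each at unit cost. *)

(* Defs.v *)
From Stdlib Require Import Reals ZArith List ClassicalEpsilon.
Import ListNotations.
Open Scope R_scope.

(** * Real exponential sums *)

(** A term (a, c) stands for c x^a; a sum is given by listing its terms in an
    arbitrary order, so that k is the length of the list. *)
Definition expsum := list (R * R).

Definition exponents (f : expsum) : list R := map fst f.

(** The empty sum is excluded: it vanishes identically and has no degree. *)
Definition is_expsum (f : expsum) : Prop :=
  f <> [] /\ NoDup (exponents f) /\ Forall (fun t => snd t <> 0) f.

(** Only used at x > 0, where [Rpower] is the real power function. *)
Definition eval (f : expsum) (x : R) : R :=
  fold_right Rplus 0 (map (fun t => snd t * Rpower x (fst t)) f).

Definition integral_exponents (f : expsum) : Prop :=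
  Forall (fun a => exists n : Z, a = IZR n) (exponents f).

Definition max_diff (f : expsum) : R :=
  fold_right Rmax 0
    (map (fun p => fst p - snd p) (list_prod (exponents f) (exponents f))).

(** min {1, min |a - a'|}, over the pairs of distinct exponents. *)
Definition min_gap1 (f : expsum) : R :=
  fold_right Rmin 1
    (map (fun p => Rabs (fst p - snd p))
       (filter (fun p => if Req_EM_T (fst p) (snd p) then false else true)
          (list_prod (exponents f) (exponents f)))).

(** For a monomial, [max_diff] is 0, hence so is the degree. *)
Definition degree (f : expsum) : R :=
  if excluded_middle_informative (integral_exponents f)
  then max_diff f
  else max_diff f / min_gap1 f.

Definition sign_alternation (f : expsum) (p : (R * R) * (R * R)) : Prop :=
  let (t, t') := p in
  fst t < fst t' /\
  (forall b, In b (exponents f) -> ~ (fst t < b < fst t')) /\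
  snd t * snd t' < 0.

Definition sign_alternations (f : expsum) : nat :=
  length (filter
    (fun p => if excluded_middle_informative (sign_alternation f p)
              then true else false)
    (list_prod f f)).

(** * A real random-access machine *)

(** [reg] holds the real working registers and [mem] an unbounded real array.
    The natural numbers in [idx] serve only as addresses into [mem] and as loop
    counters; they can never be transferred to the reals or conversely. *)
Record state := State { reg : nat -> R; mem : nat -> R; idx : nat -> nat }.

Definition upd {T : Type} (m : nat -> T) (i : nat) (v : T) : nat -> T :=
  fun j => if Nat.eqb j i then v else m j.

Inductive arith := Add | Sub | Mul | Div.

Inductive test :=
| RegLt (a b : nat)
| IdxLt (i j : nat).

(** The only built-in constants are integers.  [Pow] is the power oracle. *)
Inductive cmd :=
| Const (r : nat) (z : Z)
| Arith (o : arith) (r a b : nat)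
| Pow (r a b : nat)
| MemGet (r i : nat)
| MemSet (i r : nat)
| IdxSet (i n : nat)
| IdxCopy (i j : nat)
| IdxIncr (i : nat)
| IdxDecr (i : nat)
| Skip
| Seq (c1 c2 : cmd)
| If (b : test) (c1 c2 : cmd)
| While (b : test) (c : cmd).

Definition arith_defined (o : arith) (y : R) : Prop :=
  match o with Div => y <> 0 | _ => True end.

Definition arith_sem (o : arith) (x y : R) : R :=
  match o with
  | Add => x + y
  | Sub => x - y
  | Mul => x * y
  | Div => x / y
  end.

Definition test_sem (b : test) (s : state) : Prop :=
  match b with
  | RegLt a b => reg s a < reg s b
  | IdxLt i j => (idx s i < idx s j)%nat
  end.

Definition set_reg (s : state) (r : nat) (v : R) : state :=
  State (upd (reg s) r v) (mem s) (idx s).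
Definition set_mem (s : state) (n : nat) (v : R) : state :=
  State (reg s) (upd (mem s) n v) (idx s).
Definition set_idx (s : state) (i n : nat) : state :=
  State (reg s) (mem s) (upd (idx s) i n).

(** [exec c s t s']: started in [s], [c] terminates in [s'] at cost [t].  Every
    operation has cost 1: arithmetic, oracle calls and comparisons, but also
    memory accesses and index manipulations, so [t] bounds in particular the
    number of arithmetic operations.  A division by zero, or an oracle call at
    a base x <= 0 (where x^r need not be a real number), has no outcome: a
    program performing one does not terminate. *)
Inductive exec : cmd -> state -> nat -> state -> Prop :=
| exec_Const s r z : exec (Const r z) s 1 (set_reg s r (IZR z))
| exec_Arith s o r a b :
    arith_defined o (reg s b) ->
    exec (Arith o r a b) s 1 (set_reg s r (arith_sem o (reg s a) (reg s b)))
| exec_Pow s r a b :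
    0 < reg s a ->
    exec (Pow r a b) s 1 (set_reg s r (Rpower (reg s a) (reg s b)))
| exec_MemGet s r i : exec (MemGet r i) s 1 (set_reg s r (mem s (idx s i)))
| exec_MemSet s i r : exec (MemSet i r) s 1 (set_mem s (idx s i) (reg s r))
| exec_IdxSet s i n : exec (IdxSet i n) s 1 (set_idx s i n)
| exec_IdxCopy s i j : exec (IdxCopy i j) s 1 (set_idx s i (idx s j))
| exec_IdxIncr s i : exec (IdxIncr i) s 1 (set_idx s i (S (idx s i)))
| exec_IdxDecr s i : exec (IdxDecr i) s 1 (set_idx s i (pred (idx s i)))
| exec_Skip s : exec Skip s 1 s
| exec_Seq s s1 s2 c1 c2 t1 t2 :
    exec c1 s t1 s1 -> exec c2 s1 t2 s2 -> exec (Seq c1 c2) s (t1 + t2) s2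
| exec_If_true s s' b c1 c2 t :
    test_sem b s -> exec c1 s t s' -> exec (If b c1 c2) s (S t) s'
| exec_If_false s s' b c1 c2 t :
    ~ test_sem b s -> exec c2 s t s' -> exec (If b c1 c2) s (S t) s'
| exec_While_true s s1 s2 b c t1 t2 :
    test_sem b s -> exec c s t1 s1 -> exec (While b c) s1 t2 s2 ->
    exec (While b c) s (S (t1 + t2)) s2
| exec_While_false s b c : ~ test_sem b s -> exec (While b c) s 1 s.

Fixpoint oracle_free (c : cmd) : Prop :=
  match c with
  | Pow _ _ _ => False
  | Seq c1 c2 | If _ c1 c2 => oracle_free c1 /\ oracle_free c2
  | While _ c => oracle_free c
  | _ => True
  end.

(** * Root approximation *)

(** The array holds a_1, c_1, ..., a_k, c_k; index register 0 holds k; real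
    registers 0 and 1 hold the radius and the precision; all else is 0. *)
Definition input (f : expsum) (rad eps : R) : state :=
  State (fun r => nth r [rad; eps] 0)
        (fun n => nth n (flat_map (fun t => [fst t; snd t]) f) 0)
        (fun i => nth i [length f] 0%nat).

(** Index register 0 holds the number of output points, which are stored at the
    beginning of the array. *)
Definition output (s : state) : list R := map (mem s) (seq 0 (idx s 0%nat)).

(** There are exactly as many output points as roots in (0, rad), so the roots
    are counted too. *)
Definition approximates_roots (f : expsum) (rad eps : R) (ys : list R) : Prop :=
  exists zs : list R,
    NoDup zs /\
    (forall x, In x zs <-> 0 < x < rad /\ eval f x = 0) /\
    Forall2 (fun y z => Rabs (y - z) <= eps) ys zs.

Definition solves_in (P : cmd) (f : expsum) (rad eps : R) (bound : R) : Prop :=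
  exists (t : nat) (s : state),
    exec P (input f rad eps) t s /\
    approximates_roots f rad eps (output s) /\
    INR t <= bound.

(** Logarithm inside a big-O: truncated below at 1, so that bounds involving
    log d or log log (R / eps) stay meaningful when these are small, negative
    or undefined. *)
Definition lg (x : R) : R := Rmax 1 (ln x).

(* Main.v *)
Require Import Defs.
From Stdlib Require Import Reals ZArith List Lra Lia ClassicalEpsilon.
Import ListNotations.
Open Scope R_scope.

(** A sum with at most one sign alternation has at most one positive root.  After
    multiplying f by x^-b and by a sign, where b is the largest exponent on the
    negative side, every term is a nondecreasing function of x and the positive
    ones increase strictly; so the sign of f(x) tells on which side of the root z
    the point x lies ([eval_sign_increases]).  If all coefficients have the same
    sign, there is no root at all.

    To locate z in (eps, rad) with few evaluations, three searches are chained.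

    - The numbers 2^(2^i), obtained by repeated squaring, serve for a binary
      search on log2 (z / eps): m = O(log log (rad / eps)) evaluations give lo
      with lo <= z <= 2 lo.  The table is kept in memory, so that the search can
      run through it downwards without square roots.

    - Bisection in [lo, 2 lo] makes the relative error at most 1 / (40 D), where
      D = 1 + (largest exponent difference); since D <= 2 d, this takes
      O(log d) evaluations.

    - From there, Newton's iteration for x^-b f(x) converges quadratically
      ([newton_step]): each step replaces q = 20 D |z/x - 1| by at most q^2.  As
      q <= 1/2 at the start, m steps give q <= 2^-(2^m), which is at most
      eps / rad, as the table ends when 2^(2^m) >= rad / eps.

    The convergence is proved term by term, without estimating derivatives of f:
    with r = z/x and beta = a - b, the relative error of a Newton step is the sum of
    the second-order remainders r^beta - 1 - beta (r - 1), weighted by the terms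
    c x^a and divided by the sum of the c beta x^a.  Each remainder is at most
    10 D (r - 1)^2 |beta|, so the divisor cancels against the sum of the bounds.
    This is where the single sign change enters: it makes all the products
    c (a - b) nonnegative.

    An evaluation costs O(k) operations and k powers.  The same program
    ([solver]) is used twice, with a power computed either by the oracle or, for
    integer exponents, by repeated squaring in O(log d) operations; exponents are
    first shifted by the smallest one, so that they are natural numbers at most
    d.  No sorting is needed, since the sign change is found from the extreme
    terms and one more pass over the list. *)

(** * Sums over terms *)

Lemma Rabs_le_inv x y : Rabs x <= y -> - y <= x <= y.
Proof.
  intros H. split; [|exact (Rle_trans _ _ _ (Rle_abs x) H)].
  assert (H' := Rle_abs (- x)). rewrite Rabs_Ropp in H'. lra.
Qed.

Definition sum (phi : R * R -> R) (f : expsum) : R := fold_right Rplus 0 (map phi f).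

Lemma eval_sum f x : eval f x = sum (fun t => snd t * Rpower x (fst t)) f.
Proof. reflexivity. Qed.

Lemma sum_app phi f g : sum phi (f ++ g) = sum phi f + sum phi g.
Proof.
  unfold sum. induction f as [|t f IH]; simpl; [lra|]. rewrite IH. lra.
Qed.

Lemma sum_ext phi psi f :
  (forall t, In t f -> phi t = psi t) -> sum phi f = sum psi f.
Proof.
  intros H. unfold sum. f_equal. now apply map_ext_in.
Qed.

Lemma sum_scal k phi f : sum (fun t => k * phi t) f = k * sum phi f.
Proof.
  unfold sum. induction f as [|t f IH]; simpl; [lra|]. rewrite IH. lra.
Qed.

Lemma sum_minus phi psi f : sum (fun t => phi t - psi t) f = sum phi f - sum psi f.
Proof.
  unfold sum. induction f as [|t f IH]; simpl; [lra|]. rewrite IH. lra.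
Qed.

Lemma sum_map phi h f : sum phi (map h f) = sum (fun t => phi (h t)) f.
Proof. unfold sum. now rewrite map_map. Qed.

Lemma sum_le phi psi f :
  (forall t, In t f -> phi t <= psi t) -> sum phi f <= sum psi f.
Proof.
  unfold sum. induction f as [|t f IH]; intros H; simpl; [lra|].
  apply Rplus_le_compat; [|apply IH; intros]; apply H; simpl; auto.
Qed.

Lemma sum_lt phi psi f :
  (forall t, In t f -> phi t <= psi t) ->
  (exists t, In t f /\ phi t < psi t) -> sum phi f < sum psi f.
Proof.
  unfold sum. induction f as [|t f IH]; intros H [u [Hu Hlt]]; simpl; [easy|].
  assert (Ht : phi t <= psi t) by (apply H; simpl; auto).
  assert (Hf : fold_right Rplus 0 (map phi f) <= fold_right Rplus 0 (map psi f))
    by (apply sum_le; intros; apply H; simpl; auto).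
  destruct Hu as [->|Hu]; [lra|].
  enough (fold_right Rplus 0 (map phi f) < fold_right Rplus 0 (map psi f)) by lra.
  apply IH; [|now exists u]. intros; apply H; simpl; auto.
Qed.

Lemma sum_abs_le phi psi f :
  (forall t, In t f -> Rabs (phi t) <= psi t) -> Rabs (sum phi f) <= sum psi f.
Proof.
  intros H. apply Rabs_le. split.
  - replace (- sum psi f) with (sum (fun t => (-1) * psi t) f)
      by (rewrite sum_scal; lra).
    apply sum_le. intros t Ht. specialize (H t Ht).
    apply Rabs_le_inv in H. lra.
  - apply sum_le. intros t Ht. specialize (H t Ht).
    apply Rabs_le_inv in H. lra.
Qed.

(** * The unique sign change *)

(** The normal form of one sign change: any common bound b between the negative and
    the positive terms makes c (a - b) nonnegative for each of them. *)
Definition separated (b : R) (f : expsum) : Prop :=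
  forall t, In t f -> (snd t < 0 /\ fst t <= b) \/ (0 < snd t /\ b < fst t).

Lemma Rpower_pos x a : 0 < Rpower x a.
Proof. apply exp_pos. Qed.

(** A sum without sign alternation; [c] only serves to name the common sign. *)
Lemma eval_same_sign f c x : f <> [] ->
  (forall t, In t f -> 0 < snd t * c) -> eval f x <> 0.
Proof.
  intros Hne H E.
  assert (Hs : sum (fun _ => 0 * 0) f < sum (fun t => c * (snd t * Rpower x (fst t))) f).
  { destruct f as [|u f']; [easy|]. apply sum_lt.
    - intros t Ht. specialize (H t Ht). assert (HP := Rpower_pos x (fst t)). nra.
    - exists u. split; [now left|]. specialize (H u (or_introl eq_refl)).
      assert (HP := Rpower_pos x (fst u)). nra. }
  rewrite !sum_scal in Hs. rewrite <- eval_sum, E in Hs. lra.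
Qed.

(** Passing from x to x r multiplies the term of exponent a by r^a; dividing by the
    common factor r^b turns a negative term and a positive one, when [separated]
    by b, both into nondecreasing functions of r. *)
Lemma eval_tilt f b x r : 0 < x -> 0 < r ->
  Rpower r (- b) * eval f (x * r)
  = sum (fun t => snd t * Rpower x (fst t) * Rpower r (fst t - b)) f.
Proof.
  intros Hx Hr. rewrite eval_sum, <- sum_scal. apply sum_ext. intros t _.
  unfold Rminus. rewrite Rpower_plus. rewrite <- Rpower_mult_distr by assumption. ring.
Qed.

Lemma Rpower_ge_1 r a : 0 < r -> 0 <= a * ln r -> 1 <= Rpower r a.
Proof.
  intros Hr H. rewrite <- exp_0. unfold Rpower.
  destruct H as [H|H]; [left; now apply exp_increasing|rewrite <- H; lra].
Qed.

Lemma Rpower_le_1 r a : 0 < r -> a * ln r <= 0 -> Rpower r a <= 1.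
Proof.
  intros Hr H. rewrite <- exp_0. unfold Rpower.
  destruct H as [H|H]; [left; now apply exp_increasing|rewrite H; lra].
Qed.

(** This replaces the monotonicity of x^-b f(x): all that the searches and the
    uniqueness of the root use is the order of the signs. *)
Lemma eval_sign_increases f b x y :
  separated b f -> (exists t, In t f /\ 0 < snd t) -> 0 < x -> x < y ->
  0 <= eval f x -> 0 < eval f y.
Proof.
  intros Hs [p [Hp Hp0]] Hx Hxy H0.
  set (r := y / x).
  assert (Hr : 1 < r).
  { unfold r. apply (Rmult_lt_reg_r x); [lra|]. field_simplify; lra. }
  assert (Hl : 0 < ln r) by (rewrite <- ln_1; apply ln_increasing; lra).
  assert (Ht := eval_tilt f b x r Hx ltac:(lra)).
  replace (x * r) with y in Ht by (unfold r; field; lra).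
  assert (Hlt : eval f x < Rpower r (- b) * eval f y).
  { rewrite Ht. apply sum_lt.
    - intros t Hin. assert (HP := Rpower_pos x (fst t)).
      destruct (Hs t Hin) as [[H1 H2]|[H1 H2]].
      + assert (Rpower r (fst t - b) <= 1) by (apply Rpower_le_1; nra).
        assert (snd t * Rpower x (fst t) <= 0) by nra. nra.
      + assert (1 <= Rpower r (fst t - b)) by (apply Rpower_ge_1; nra).
        assert (0 <= snd t * Rpower x (fst t)) by nra. nra.
    - exists p. split; [assumption|]. assert (HP := Rpower_pos x (fst p)).
      destruct (Hs p Hp) as [[H1 H2]|[H1 H2]]; [lra|].
      assert (1 < Rpower r (fst p - b)).
      { rewrite <- exp_0. apply exp_increasing. apply Rmult_lt_0_compat; lra. }
      assert (0 < snd p * Rpower x (fst p)) by nra. nra. }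
  assert (HP := Rpower_pos r (- b)). nra.
Qed.

(** In x^-b f(x), positive terms tend to 0 at 0 and negative ones do not increase
    as x goes to 0. *)
Lemma eval_neg_near_zero f b :
  separated b f -> (exists t, In t f /\ snd t < 0) ->
  exists del, 0 < del /\ forall x, 0 < x -> x < del -> eval f x < 0.
Proof.
  intros Hs Hneg.
  (* Induction on the terms: each positive term uses up half of [eta]. *)
  assert (Hub : forall g eta, separated b g -> 0 < eta -> exists del, 0 < del /\
    forall x, 0 < x -> x < del ->
      sum (fun t => snd t * Rpower x (fst t - b)) g
      <= eta + sum (fun t => Rmin (snd t) 0) g).
  { induction g as [|t g IH]; intros eta Hg He.
    - exists 1. split; [lra|]. intros; unfold sum; simpl; lra.
    - destruct (IH (eta / 2)) as [d1 [Hd1 H1]];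
        [intros u Hu; apply Hg; simpl; auto | lra |].
      destruct (Hg t (or_introl eq_refl)) as [[Hc Ha]|[Hc Ha]].
      + exists (Rmin 1 d1). split; [apply Rmin_glb_lt; lra|].
        intros x Hx Hlt. assert (Hx1 := Rmin_l 1 d1). assert (Hx2 := Rmin_r 1 d1).
        specialize (H1 x Hx ltac:(lra)). unfold sum in *; simpl.
        assert (Hp : 1 <= Rpower x (fst t - b)).
        { apply Rpower_ge_1; [lra|].
          assert (ln x < 0) by (rewrite <- ln_1; apply ln_increasing; lra). nra. }
        rewrite Rmin_left by lra. nra.
      + set (d2 := Rpower (eta / 2 / snd t) (/ (fst t - b))).
        assert (Hd2 : 0 < d2) by apply Rpower_pos.
        exists (Rmin d2 d1). split; [apply Rmin_glb_lt; lra|].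
        intros x Hx Hlt. assert (Hx1 := Rmin_l d2 d1). assert (Hx2 := Rmin_r d2 d1).
        specialize (H1 x Hx ltac:(lra)). unfold sum in *; simpl.
        assert (Hq : 0 < eta / 2 / snd t) by (repeat apply Rdiv_lt_0_compat; lra).
        assert (Hp : Rpower x (fst t - b) <= eta / 2 / snd t).
        { replace (eta / 2 / snd t) with (Rpower d2 (fst t - b)).
          - apply Rle_Rpower_l; lra.
          - unfold d2. rewrite Rpower_mult, Rinv_l, Rpower_1; lra. }
        apply (Rmult_le_compat_l (snd t)) in Hp; [|lra].
        replace (snd t * (eta / 2 / snd t)) with (eta / 2) in Hp by (field; lra).
        rewrite Rmin_right by lra. lra. }
  set (m := sum (fun t => Rmin (snd t) 0) f).
  assert (Hm : m < 0).
  { replace 0 with (sum (fun _ => 0) f).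
    - apply sum_lt; [intros; apply Rmin_r|].
      destruct Hneg as [t [Hin Ht]]. exists t. rewrite Rmin_left by lra. now split.
    - rewrite (sum_ext _ (fun t => 0 * 0)) by (intros; ring). rewrite sum_scal. ring. }
  destruct (Hub f (- m / 2) Hs ltac:(lra)) as [del [Hdel H]].
  exists del. split; [assumption|]. intros x Hx Hlt. specialize (H x Hx Hlt).
  (* The bound concerns x^-b f(x), which has the sign of f(x). *)
  assert (Ht := eval_tilt f b 1 x ltac:(lra) Hx). rewrite Rmult_1_l in Ht.
  rewrite (sum_ext _ (fun t => snd t * Rpower x (fst t - b))) in Ht.
  2:{ intros t _. unfold Rpower at 1. rewrite ln_1, Rmult_0_r, exp_0. ring. }
  fold m in H. rewrite <- Ht in H. assert (HP := Rpower_pos x (- b)). nra.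
Qed.

(** The substitution x = exp u gives a function continuous on the whole line, as the
    intermediate value theorem requires. *)
Lemma continuity_eval_exp f : continuity (fun u => eval f (exp u)).
Proof.
  unfold eval. induction f as [|t f IH]; simpl.
  - apply continuity_const. now intros ? ?.
  - apply (continuity_plus (fun u => snd t * Rpower (exp u) (fst t))); [|exact IH].
    apply (continuity_scal (fun u => Rpower (exp u) (fst t))).
    apply derivable_continuous.
    intros u. unfold Rpower.
    apply (derivable_pt_comp (fun u => fst t * ln (exp u)) exp).
    + exists (fst t). apply (derivable_pt_lim_ext (fun u => fst t * u)).
      * intros v. now rewrite ln_exp.
      * assert (H := derivable_pt_lim_scal id (fst t) u 1 (derivable_pt_lim_id u)).
        rewrite Rmult_1_r in H. exact H.
    + apply derivable_pt_exp.
Qed.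

Lemma root_between f x y : 0 < x -> x < y -> eval f x < 0 -> 0 < eval f y ->
  exists z, x < z < y /\ eval f z = 0.
Proof.
  intros Hx Hxy H0 H1.
  destruct (IVT (fun u => eval f (exp u)) (ln x) (ln y)) as [u [Hu Hz]].
  - apply continuity_eval_exp.
  - now apply ln_increasing.
  - now rewrite exp_ln.
  - rewrite exp_ln; lra.
  - assert (Hne : forall v, v = exp u -> eval f v = 0) by now intros v ->.
    exists (exp u). split; [|exact Hz]. destruct Hu as [[Hu1|Hu1] [Hu2|Hu2]].
    + apply exp_increasing in Hu1, Hu2. rewrite exp_ln in Hu1, Hu2; lra.
    + rewrite (Hne y) in H1; [lra|]. rewrite Hu2, exp_ln; lra.
    + rewrite (Hne x) in H0; [lra|]. rewrite <- Hu1, exp_ln; lra.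
    + rewrite (Hne x) in H0; [lra|]. rewrite <- Hu1, exp_ln; lra.
Qed.

(** * Newton's iteration *)

(** The function x^(1+b) (x^-b f(x))', by which Newton's step for x^-b f(x) divides. *)
Definition slope (b : R) (f : expsum) (x : R) : R :=
  sum (fun t => snd t * (fst t - b) * Rpower x (fst t)) f.

(** Both bounds come from 1 + t <= exp t, applied to t and to - t. *)
Lemma exp_second_order t : Rabs t <= 1 / 2 -> 0 <= exp t - 1 - t <= 2 * t ^ 2.
Proof.
  intros Ht. apply Rabs_le_inv in Ht.
  assert (H1 := exp_ineq1_le t). assert (H2 := exp_ineq1_le (- t)).
  assert (H3 : exp t * exp (- t) = 1) by (rewrite <- exp_plus, Rplus_opp_r; apply exp_0).
  split; [lra|].
  assert (exp t * (1 - t) <= 1) by (assert (0 < exp t) by apply exp_pos; nra).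
  nra.
Qed.

Lemma ln_second_order r : 1 / 2 <= r -> 0 <= r - 1 - ln r <= 2 * (r - 1) ^ 2.
Proof.
  intros Hr. assert (H1 := exp_ineq1_le (ln r)). assert (H2 := exp_ineq1_le (- ln r)).
  rewrite exp_ln in H1 by lra. rewrite exp_Ropp, exp_ln in H2 by lra.
  split; [lra|].
  assert (H3 : r * / r = 1) by (apply Rinv_r; lra).
  assert (H4 : / r <= 2) by nra.
  assert (r - 1 - ln r <= (r - 1) ^ 2 * / r).
  { replace ((r - 1) ^ 2 * / r) with (r - 2 + / r) by (field; lra). lra. }
  assert (0 <= (r - 1) ^ 2) by apply pow2_ge_0. nra.
Qed.

(** The factor |beta|, rather than a constant, is what allows the remainders of all
    terms to be absorbed by the derivative.  It is obtained by splitting the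
    remainder into exp (beta y) - 1 - beta y and beta (y - (r - 1)) with y = ln r:
    the first is O(beta^2 y^2) and the second O(|beta| (r - 1)^2). *)
Lemma Rpower_second_order D r beta :
  1 <= D -> Rabs beta <= D -> D * Rabs (r - 1) <= 1 / 4 ->
  Rabs (Rpower r beta - 1 - beta * (r - 1)) <= 10 * D * (r - 1) ^ 2 * Rabs beta.
Proof.
  intros HD Hb Hr.
  assert (Hr1 : Rabs (r - 1) <= 1 / 4) by (assert (H := Rabs_pos (r - 1)); nra).
  assert (Hr2 := Hr1). apply Rabs_le_inv in Hr2.
  destruct (ln_second_order r) as [L1 L2]; [lra|].
  set (y := ln r) in *.
  assert (Hy : Rabs y <= 2 * Rabs (r - 1)).
  { replace y with ((r - 1) - (r - 1 - y)) by ring.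
    eapply Rle_trans; [apply Rabs_triang|]. rewrite Rabs_Ropp.
    rewrite (Rabs_right (r - 1 - y)) by lra.
    rewrite <- pow2_abs in L2. assert (H := Rabs_pos (r - 1)). nra. }
  assert (Hby : Rabs (beta * y) <= 1 / 2).
  { rewrite Rabs_mult. assert (H := Rabs_pos y). assert (H' := Rabs_pos beta). nra. }
  destruct (exp_second_order _ Hby) as [E1 E2].
  unfold Rpower. fold y.
  replace (exp (beta * y) - 1 - beta * (r - 1)) with
    ((exp (beta * y) - 1 - beta * y) + - (beta * (r - 1 - y))) by ring.
  eapply Rle_trans; [apply Rabs_triang|]. rewrite Rabs_Ropp, Rabs_mult.
  rewrite (Rabs_right (exp _ - _ - _)) by lra. rewrite (Rabs_right (r - 1 - y)) by lra.
  assert (Hy2 : (beta * y) ^ 2 <= 4 * D * (r - 1) ^ 2 * Rabs beta).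
  { rewrite Rpow_mult_distr, <- (pow2_abs beta), <- (pow2_abs y), <- (pow2_abs (r - 1)).
    assert (H := Rabs_pos y). assert (H' := Rabs_pos beta). assert (H'' := Rabs_pos (r-1)).
    assert (Rabs y ^ 2 <= 4 * Rabs (r - 1) ^ 2) by nra.
    assert (Rabs beta ^ 2 <= D * Rabs beta) by nra.
    assert (0 <= Rabs y ^ 2) by nra. assert (0 <= Rabs beta ^ 2) by nra.
    apply Rle_trans with ((D * Rabs beta) * (4 * Rabs (r - 1) ^ 2)); [|nra].
    apply Rmult_le_compat; assumption. }
  assert (0 <= (r - 1) ^ 2 * Rabs beta)
    by (apply Rmult_le_pos; [apply pow2_ge_0|apply Rabs_pos]).
  assert (Rabs beta * (r - 1 - y) <= 2 * D * (r - 1) ^ 2 * Rabs beta).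
  { assert (H' := Rabs_pos beta).
    apply Rle_trans with (Rabs beta * (2 * (r - 1) ^ 2)); [nra|]. nra. }
  lra.
Qed.

(** Since f(z) = 0, the sum of v_t r^(a_t - b) vanishes, where r = z/x and the v_t are
    the terms of f(x).  Hence the exact correction x (r - 1) and Newton's differ by
    x / slope times the sum of the v_t weighted by second-order remainders, which is
    at most 10 D (r - 1)^2 slope.  Measuring the error relative to the new point
    costs at most another factor 2. *)
Lemma newton_step f b D x z :
  separated b f -> (exists t, In t f /\ 0 < snd t) ->
  (forall t, In t f -> Rabs (fst t - b) <= D) -> 1 <= D ->
  0 < x -> 0 < z -> eval f z = 0 -> 20 * D * Rabs (z / x - 1) <= 1 / 2 ->
  let x' := x - x * (eval f x / slope b f x) in
  0 < slope b f x /\ 0 < x' /\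
  20 * D * Rabs (z / x' - 1) <= (20 * D * Rabs (z / x - 1)) ^ 2.
Proof.
  intros Hs [p [Hp Hp0]] HD HD1 Hx Hz Hroot Hq.
  set (r := z / x) in *.
  assert (Hr : 0 < r) by (apply Rdiv_lt_0_compat; lra).
  assert (Hv : forall t, In t f -> 0 <= snd t * (fst t - b) * Rpower x (fst t)).
  { intros t Ht. assert (HP := Rpower_pos x (fst t)).
    apply Rmult_le_pos; [|lra]. destruct (Hs t Ht) as [[? ?]|[? ?]]; nra. }
  assert (HS : 0 < slope b f x).
  { replace 0 with (sum (fun t => 0 * 0) f) by (rewrite sum_scal; ring).
    apply sum_lt; [intros; rewrite Rmult_0_l; auto|]. exists p. split; [assumption|].
    assert (HP := Rpower_pos x (fst p)).
    destruct (Hs p Hp) as [[? ?]|[? ?]]; [lra|].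
    rewrite Rmult_0_l. apply Rmult_lt_0_compat; nra. }
  set (S := slope b f x) in *.
  intros x'. split; [assumption|].
  assert (Ht := eval_tilt f b x r Hx Hr).
  replace (x * r) with z in Ht by (unfold r; field; lra). rewrite Hroot, Rmult_0_r in Ht.
  (* Subtracting the vanishing sum makes the remainders appear. *)
  assert (Hid : S * (1 - r) - eval f x =
    sum (fun t => snd t * Rpower x (fst t) *
                  (Rpower r (fst t - b) - 1 - (fst t - b) * (r - 1))) f).
  { rewrite (sum_ext _ (fun t =>
      (snd t * Rpower x (fst t) * Rpower r (fst t - b) - snd t * Rpower x (fst t))
      - (r - 1) * (snd t * (fst t - b) * Rpower x (fst t)))) by (intros; ring).
    rewrite !sum_minus, sum_scal, <- Ht. rewrite eval_sum. unfold S, slope. ring. }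
  assert (Hab : Rabs (S * (1 - r) - eval f x) <= 10 * D * (r - 1) ^ 2 * S).
  { rewrite Hid. unfold S, slope. rewrite <- sum_scal. apply sum_abs_le.
    intros t Hin. rewrite Rabs_mult.
    assert (H2 := Rpower_second_order D r (fst t - b) HD1 (HD t Hin) ltac:(lra)).
    apply Rle_trans with (Rabs (snd t * Rpower x (fst t)) *
      (10 * D * (r - 1) ^ 2 * Rabs (fst t - b))).
    - apply Rmult_le_compat_l; [apply Rabs_pos|assumption].
    - right. rewrite <- (Rabs_right _ (Rle_ge _ _ (Hv t Hin))).
      rewrite !Rabs_mult. ring. }
  set (rho := Rabs (r - 1)) in *.
  assert (Hrho : 0 <= rho) by apply Rabs_pos.
  rewrite <- pow2_abs in Hab. fold rho in Hab.
  (* [e] is the error of the step relative to x, as x' = x (r + e). *)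
  set (e := 1 - r - eval f x / S).
  assert (He : Rabs e <= 10 * D * rho ^ 2).
  { unfold e. replace (1 - r - eval f x / S) with ((S * (1 - r) - eval f x) / S)
      by (field; lra).
    unfold Rdiv. rewrite Rabs_mult, (Rabs_right (/ S)) by (left; now apply Rinv_0_lt_compat).
    apply (Rmult_le_reg_r S); [assumption|]. rewrite Rmult_assoc, Rinv_l by lra. lra. }
  assert (Hxe : x' = x * (r + e)) by (unfold x', e; field; lra).
  assert (Hr1 : 1 - rho <= r) by
    (unfold rho; assert (H := Rabs_le_inv _ _ (Rle_refl (Rabs (r - 1)))); lra).
  assert (Hrho' : rho <= 1 / 40) by nra.
  assert (HDr : 10 * D * rho ^ 2 <= 1 / 4 * rho) by nra.
  assert (He' := Rabs_le_inv _ _ He).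
  assert (Hre : 1 / 2 <= r + e) by lra.
  split; [rewrite Hxe; apply Rmult_lt_0_compat; lra|].
  replace (z / x' - 1) with (- e / (r + e)).
  2:{ assert (Hz' : z = x * r) by (unfold r; field; lra).
      rewrite Hxe, Hz'. field. split; lra. }
  unfold Rdiv. rewrite Rabs_mult, Rabs_Ropp.
  rewrite (Rabs_right (/ (r + e))) by (left; apply Rinv_0_lt_compat; lra).
  assert (Hinv : / (r + e) <= 2).
  { replace 2 with (/ (1 / 2)) by field. apply Rinv_le_contravar; lra. }
  assert (0 <= / (r + e)) by (left; apply Rinv_0_lt_compat; lra).
  apply Rle_trans with (20 * D * (10 * D * rho ^ 2 * 2)); [|right; ring].
  apply Rmult_le_compat_l; [lra|]. apply Rmult_le_compat; auto. apply Rabs_pos.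
Qed.

(** * Sign alternations *)

Lemma filter_length_lt {A} (p q : A -> bool) l a :
  (forall x, q x = true -> p x = true) -> In a l -> p a = true -> q a = false ->
  (length (filter q l) < length (filter p l))%nat.
Proof.
  intros Hqp Hin Hp Hq.
  assert (Hle : forall l, (length (filter q l) <= length (filter p l))%nat).
  { clear l Hin. induction l as [|x l IH]; simpl; [lia|].
    specialize (Hqp x). destruct (q x), (p x); simpl; lia. }
  induction l as [|x l IH]; simpl in *; [easy|].
  destruct Hin as [->|Hin].
  - rewrite Hp, Hq. simpl. specialize (Hle l). lia.
  - specialize (IH Hin). specialize (Hqp x). destruct (q x), (p x); simpl; lia.
Qed.

Definition between (x y a : R) : bool :=
  if Rlt_dec x a then if Rlt_dec a y then true else false else false.

Lemma between_spec x y a : between x y a = true <-> x < a < y.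
Proof.
  unfold between. destruct (Rlt_dec x a), (Rlt_dec a y); split; try easy; lra.
Qed.

(** If u lies strictly between t and t', its sign differs from that of one of them, so
    that one of the gaps (t, u) and (u, t') is again a change of sign, containing
    fewer exponents; in either case the sign on the left is that of t. *)
Lemma alternation_between f t t' :
  Forall (fun t => snd t <> 0) f -> In t f -> In t' f ->
  fst t < fst t' -> snd t * snd t' < 0 ->
  exists p p', In p f /\ In p' f /\ 0 < snd t * snd p /\
    sign_alternation f (p, p').
Proof.
  intros Hnz. rewrite Forall_forall in Hnz.
  remember (length (filter (between (fst t) (fst t')) (exponents f))) as n eqn:Hn.
  revert t t' Hn. induction n as [n IH] using lt_wf_ind.
  intros t t' Hn Ht Ht' Hlt Hc.
  destruct (classic (exists u, In u f /\ fst t < fst u < fst t')) as [[u [Hu Hb]]|Hno].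
  - assert (Hu0 := Hnz u Hu).
    assert (Hin : In (fst u) (exponents f)) by now apply in_map.
    destruct (Rlt_or_le 0 (snd t * snd u)) as [Hs|Hs].
    + destruct (IH (length (filter (between (fst u) (fst t')) (exponents f))))
        with (t := u) (t' := t') as (p & p' & Hp & Hp' & Hpos & Halt);
        auto; try lra.
      * rewrite Hn. apply filter_length_lt with (a := fst u); auto.
        -- intros x. rewrite !between_spec. lra.
        -- now apply between_spec.
        -- destruct (between (fst u) (fst t') (fst u)) eqn:E; auto.
           apply between_spec in E. lra.
      * nra.
      * refine (ex_intro _ p (ex_intro _ p' (conj Hp (conj Hp' (conj _ Halt))))). nra.
    + destruct (IH (length (filter (between (fst t) (fst u)) (exponents f))))
        with (t := t) (t' := u) as (p & p' & Hp & Hp' & Hpos & Halt);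
        auto; try lra.
      * rewrite Hn. apply filter_length_lt with (a := fst u); auto.
        -- intros x. rewrite !between_spec. lra.
        -- now apply between_spec.
        -- destruct (between (fst t) (fst u) (fst u)) eqn:E; auto.
           apply between_spec in E. lra.
      * assert (snd t <> 0) by now apply Hnz.
        destruct Hs as [Hs|Hs]; [lra|]. apply Rmult_integral in Hs. tauto.
      * now exists p, p'.
  - exists t, t'. repeat split; auto.
    + assert (snd t <> 0) by now apply Hnz. nra.
    + intros b Hb Hbt. apply in_map_iff in Hb. destruct Hb as [u [<- Hu]].
      apply Hno. now exists u.
Qed.

Lemma two_le_length {A} (l : list A) a b :
  In a l -> In b l -> a <> b -> (2 <= length l)%nat.
Proof.
  destruct l as [|x [|y l]]; simpl; [easy| |lia].
  intros [->|[]] [->|[]] H. easy.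
Qed.

(** Two changes of sign in opposite directions lead to two alternations that differ in
    the sign on the left. *)
Lemma at_most_one_sign_change f t1 t2 t3 t4 :
  is_expsum f -> (sign_alternations f <= 1)%nat ->
  In t1 f -> In t2 f -> In t3 f -> In t4 f ->
  fst t1 < fst t2 -> fst t3 < fst t4 ->
  snd t1 * snd t2 < 0 -> snd t3 * snd t4 < 0 -> snd t1 * snd t3 < 0 -> False.
Proof.
  intros (_ & _ & Hnz) Halt H1 H2 H3 H4 L1 L2 S1 S2 S3.
  destruct (alternation_between f t1 t2) as (p & p' & Hp & Hp' & Hs & Ha); auto.
  destruct (alternation_between f t3 t4) as (q & q' & Hq & Hq' & Hs' & Ha'); auto.
  unfold sign_alternations in Halt.
  enough (2 <= 1)%nat by lia. eapply Nat.le_trans; [|exact Halt].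
  apply (two_le_length _ (p, p') (q, q')).
  - apply filter_In. split; [now apply in_prod|].
    now destruct excluded_middle_informative.
  - apply filter_In. split; [now apply in_prod|].
    now destruct excluded_middle_informative.
  - intros E. injection E as -> ->. nra.
Qed.

Lemma same_exponent f t t' :
  NoDup (exponents f) -> In t f -> In t' f -> fst t = fst t' -> t = t'.
Proof.
  unfold exponents. induction f as [|u f IH]; simpl; [easy|].
  intros Hnd Ht Ht' E. inversion Hnd as [|? ? Hu Hnd']; subst.
  destruct Ht as [<-|Ht], Ht' as [<-|Ht']; auto.
  - exfalso. apply Hu. rewrite E. now apply in_map.
  - exfalso. apply Hu. rewrite <- E. now apply in_map.
Qed.

Section Signs.

Variables (f : expsum) (lo hi : R * R).
Hypothesis Hf : is_expsum f.
Hypothesis Halt : (sign_alternations f <= 1)%nat.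
Hypothesis Hlo : In lo f.
Hypothesis Hhi : In hi f.
Hypothesis Hrange : forall t, In t f -> fst lo <= fst t <= fst hi.

Lemma coefficient_neq_0 t : In t f -> snd t <> 0.
Proof. destruct Hf as (_ & _ & H). rewrite Forall_forall in H. apply H. Qed.

Lemma exponent_lt t t' :
  In t f -> In t' f -> fst t <= fst t' -> snd t * snd t' < 0 -> fst t < fst t'.
Proof.
  intros Ht Ht' [H|H] Hs; [assumption|]. destruct Hf as (_ & Hnd & _).
  rewrite (same_exponent f t t') in Hs; auto. nra.
Qed.

Lemma same_sign_constant t : 0 < snd lo * snd hi -> In t f -> 0 < snd t * snd hi.
Proof.
  intros H Ht. assert (H1 := coefficient_neq_0 t Ht). assert (H2 := coefficient_neq_0 hi Hhi).
  destruct (Rtotal_order (snd t * snd hi) 0) as [Hn|[Hn|Hn]]; [|nra|assumption].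
  exfalso. assert (snd lo * snd t < 0) by nra. assert (Hr := Hrange t Ht).
  apply (at_most_one_sign_change f lo t t hi); auto;
    apply exponent_lt; auto; lra.
Qed.

Lemma signs_separated t t' : In t f -> In t' f ->
  snd t * snd hi < 0 -> 0 < snd t' * snd hi -> snd lo * snd hi < 0 -> fst t < fst t'.
Proof.
  intros Ht Ht' H1 H2 H3. assert (Hr := Hrange t Ht).
  assert (H4 : snd t * snd t' < 0) by nra.
  destruct (Rle_or_lt (fst t) (fst t')) as [H|H]; [now apply exponent_lt|].
  exfalso. apply (at_most_one_sign_change f t' t t hi); auto; try lra.
  apply exponent_lt; auto; lra.
Qed.

End Signs.

(** * Degree *)

Lemma le_fold_Rmax l x : In x l -> x <= fold_right Rmax 0 l.
Proof.
  induction l as [|y l IH]; simpl; [easy|]. intros [->|H]; [apply Rmax_l|].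
  eapply Rle_trans; [now apply IH|apply Rmax_r].
Qed.

Lemma fold_Rmin_le l x : In x l -> fold_right Rmin 1 l <= x.
Proof.
  induction l as [|y l IH]; simpl; [easy|]. intros [->|H]; [apply Rmin_l|].
  eapply Rle_trans; [apply Rmin_r|now apply IH].
Qed.

Lemma fold_Rmin_pos l : (forall x, In x l -> 0 < x) -> 0 < fold_right Rmin 1 l <= 1.
Proof.
  induction l as [|y l IH]; simpl; intros H; [lra|].
  destruct IH as [H1 H2]; [auto|]. split.
  - apply Rmin_glb_lt; auto.
  - eapply Rle_trans; [apply Rmin_r|exact H2].
Qed.

(** The real degree divides by a number at most 1, so it dominates the differences of
    exponents in both cases; it is at least 1 because the largest difference is at
    least the smallest gap. *)
Lemma degree_ge_diff f t t' : In t f -> In t' f -> fst t < fst t' ->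
  fst t' - fst t <= degree f /\ 1 <= degree f.
Proof.
  intros Ht Ht' Hlt.
  assert (He : In (fst t) (exponents f)) by now apply in_map.
  assert (He' : In (fst t') (exponents f)) by now apply in_map.
  assert (Hd : fst t' - fst t <= max_diff f).
  { apply le_fold_Rmax. apply (in_map (fun p => fst p - snd p) _ (fst t', fst t)).
    now apply in_prod. }
  unfold degree. destruct excluded_middle_informative as [Hi|Hi].
  - split; [assumption|]. unfold integral_exponents in Hi. rewrite Forall_forall in Hi.
    destruct (Hi _ He) as [n Hn], (Hi _ He') as [m Hm]. rewrite Hn, Hm in *.
    apply lt_IZR in Hlt. rewrite <- minus_IZR in Hd.
    assert (1 <= IZR (m - n)) by (apply IZR_le; lia). lra.
  - assert (Hg : 0 < min_gap1 f <= 1).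
    { apply fold_Rmin_pos. intros x Hx. apply in_map_iff in Hx.
      destruct Hx as [p [<- Hp]]. apply filter_In in Hp. destruct Hp as [_ Hp].
      destruct (Req_EM_T (fst p) (snd p)); [easy|]. apply Rabs_pos_lt. lra. }
    assert (Hg' : min_gap1 f <= fst t' - fst t).
    { rewrite <- (Rabs_right (fst t' - fst t)) by lra.
      apply fold_Rmin_le.
      apply (in_map (fun p => Rabs (fst p - snd p)) _ (fst t', fst t)).
      apply filter_In. split; [now apply in_prod|]. simpl.
      destruct Req_EM_T; [lra|easy]. }
    assert (Hi1 : 1 <= / min_gap1 f).
    { rewrite <- Rinv_1. apply Rinv_le_contravar; lra. }
    assert (Hi2 : min_gap1 f * / min_gap1 f = 1) by (apply Rinv_r; lra).
    unfold Rdiv. split; nra.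
Qed.

(** * Logarithms *)

Lemma lg_ge_1 x : 1 <= lg x.
Proof. apply Rmax_l. Qed.

Lemma ln_le_lg x : ln x <= lg x.
Proof. apply Rmax_r. Qed.

Lemma ln_le_compat x y : 0 < x -> x <= y -> ln x <= ln y.
Proof. intros Hx [H| ->]; [left; now apply ln_increasing|lra]. Qed.

Lemma le_of_ln_le x y : 0 < x -> 0 < y -> ln x <= ln y -> x <= y.
Proof.
  intros Hx Hy H. destruct (Rle_or_lt x y) as [|Hlt]; [assumption|].
  apply ln_increasing in Hlt; lra.
Qed.

Lemma lg_pow2_mult j y x : 0 < x -> 0 < y -> x <= 2 ^ j * y -> lg x <= INR j + lg y.
Proof.
  intros Hx Hy H. assert (Hj := pos_INR j). assert (Hly := lg_ge_1 y).
  apply Rmax_lub; [lra|].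
  assert (H' := ln_le_compat _ _ Hx H).
  rewrite ln_mult, ln_pow in H' by (try apply pow_lt; lra).
  assert (ln 2 < 1).
  { rewrite <- (ln_exp 1). apply ln_increasing; [lra|].
    assert (H2 := exp_ineq1 1 ltac:(lra)). lra. }
  assert (INR j * ln 2 <= INR j * 1) by (apply Rmult_le_compat_l; lra).
  assert (H3 := ln_le_lg y). lra.
Qed.

Lemma lg_Rmax_1 x : lg (Rmax 1 x) = lg x.
Proof.
  unfold lg. destruct (Rle_or_lt x 1) as [H|H].
  - rewrite (Rmax_left 1 x), ln_1, (Rmax_left 1 0) by lra.
    rewrite Rmax_left; [reflexivity|]. destruct (Rle_or_lt x 0) as [H0|H0].
    + unfold ln. destruct (Rlt_dec 0 x); [exfalso|]; lra.
    + assert (H1 := ln_le_compat x 1 H0 H). rewrite ln_1 in H1. lra.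
  - now rewrite (Rmax_right 1 x) by lra.
Qed.

Lemma exists_pow2_ge y : exists n, y <= 2 ^ n /\ INR n <= 1 + 2 * lg y.
Proof.
  destruct (Rle_or_lt y 1) as [H|H].
  { exists 0%nat. simpl. assert (H1 := lg_ge_1 y). lra. }
  assert (H2 := ln_lt_2).
  assert (Hl : 0 < ln y) by (rewrite <- ln_1; apply ln_increasing; lra).
  assert (Hq : 0 < ln y / ln 2) by (apply Rdiv_lt_0_compat; lra).
  destruct (archimed (ln y / ln 2)) as [A1 A2].
  assert (Hup : (0 < up (ln y / ln 2))%Z) by (apply lt_IZR; lra).
  exists (Z.to_nat (up (ln y / ln 2))).
  assert (HI : INR (Z.to_nat (up (ln y / ln 2))) = IZR (up (ln y / ln 2))).
  { rewrite INR_IZR_INZ, Z2Nat.id by lia. reflexivity. }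
  assert (Hqm : ln y / ln 2 * ln 2 = ln y) by (field; lra).
  rewrite HI. split.
  - apply le_of_ln_le; [lra|apply pow_lt; lra|].
    rewrite ln_pow, HI by lra. nra.
  - assert (H3 := ln_le_lg y). nra.
Qed.

(** Counts the squarings of 2 until y is reached. *)
Lemma exists_pow2_pow2_ge y :
  exists n, y <= 2 ^ (2 ^ n) /\ INR n <= 5 * lg (lg y).
Proof.
  destruct (exists_pow2_ge (2 * lg y)) as [n [Hn HnI]].
  assert (H1 := lg_ge_1 y). assert (H2 := lg_ge_1 (lg y)). assert (Hl2 := ln_lt_2).
  exists n. split.
  - destruct (Rle_or_lt y 1) as [Hy|Hy].
    { eapply Rle_trans; [exact Hy|]. apply pow_R1_Rle. lra. }
    apply le_of_ln_le; [lra|apply pow_lt; lra|].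
    rewrite ln_pow, pow_INR by lra. change (INR 2) with 2.
    assert (H3 := ln_le_lg y). nra.
  - assert (H3 := lg_pow2_mult 1 (lg y) (2 * lg y)).
    simpl in H3. lra.
Qed.

(** * Reasoning about programs and their cost *)

(** Total correctness with a cost bound; the postcondition comes last, so that the
    rules below chain without intermediate assertions. *)
Definition runs (c : cmd) (s : state) (n : nat) (Q : state -> Prop) : Prop :=
  exists t s', exec c s t s' /\ (t <= n)%nat /\ Q s'.

(* [upd] computes at explicit register numbers and stays folded at symbolic
   memory addresses. *)
Arguments upd {T} m !i v !j /.

Lemma upd_same {T} (m : nat -> T) i v : upd m i v i = v.
Proof. unfold upd. now rewrite Nat.eqb_refl. Qed.

Lemma upd_other {T} (m : nat -> T) i v j : j <> i -> upd m i v j = m j.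
Proof. unfold upd. intros H. apply Nat.eqb_neq in H. now rewrite H. Qed.

Lemma runs_weaken c s n n' (Q Q' : state -> Prop) :
  runs c s n Q -> (n <= n')%nat -> (forall s', Q s' -> Q' s') -> runs c s n' Q'.
Proof.
  intros (t & s' & H & Ht & HQ) Hn HQQ. exists t, s'.
  split; [assumption|]. split; [lia|auto].
Qed.

Lemma runs_seq n1 c1 c2 s n Q :
  runs c1 s n1 (fun s1 => runs c2 s1 (n - n1) Q) -> (n1 <= n)%nat ->
  runs (Seq c1 c2) s n Q.
Proof.
  intros (t & s1 & H1 & Ht & (t' & s2 & H2 & Ht' & HQ)) Hn.
  exists (t + t')%nat, s2. split; [now apply exec_Seq with s1|]. split; [lia|exact HQ].
Qed.

(** The commands of cost 1, gathered so that one rule steps over any of them. *)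
Inductive primitive : cmd -> state -> state -> Prop :=
| prim_Const s r z : primitive (Const r z) s (set_reg s r (IZR z))
| prim_Arith s o r a b : arith_defined o (reg s b) ->
    primitive (Arith o r a b) s (set_reg s r (arith_sem o (reg s a) (reg s b)))
| prim_Pow s r a b : 0 < reg s a ->
    primitive (Pow r a b) s (set_reg s r (Rpower (reg s a) (reg s b)))
| prim_MemGet s r i : primitive (MemGet r i) s (set_reg s r (mem s (idx s i)))
| prim_MemSet s i r : primitive (MemSet i r) s (set_mem s (idx s i) (reg s r))
| prim_IdxSet s i n : primitive (IdxSet i n) s (set_idx s i n)
| prim_IdxCopy s i j : primitive (IdxCopy i j) s (set_idx s i (idx s j))
| prim_IdxIncr s i : primitive (IdxIncr i) s (set_idx s i (S (idx s i)))
| prim_IdxDecr s i : primitive (IdxDecr i) s (set_idx s i (pred (idx s i)))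
| prim_Skip s : primitive Skip s s.

Lemma runs_primitive c s s' n (Q : state -> Prop) :
  primitive c s s' -> (1 <= n)%nat -> Q s' -> runs c s n Q.
Proof.
  intros H Hn HQ. exists 1%nat, s'. split; [|auto].
  destruct H; now constructor.
Qed.

Lemma runs_seq_primitive c1 c2 s s' n Q :
  primitive c1 s s' -> (1 <= n)%nat -> runs c2 s' (n - 1) Q -> runs (Seq c1 c2) s n Q.
Proof.
  intros H Hn H2. apply (runs_seq 1); [|assumption]. now apply runs_primitive with s'.
Qed.

Lemma runs_if b c1 c2 s n Q :
  (1 <= n)%nat ->
  (test_sem b s -> runs c1 s (n - 1) Q) -> (~ test_sem b s -> runs c2 s (n - 1) Q) ->
  runs (If b c1 c2) s n Q.
Proof.
  intros Hn H1 H2. destruct (classic (test_sem b s)) as [H|H].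
  - destruct (H1 H) as (t & s' & He & Ht & HQ). exists (S t), s'.
    split; [now apply exec_If_true|]. split; [lia|assumption].
  - destruct (H2 H) as (t & s' & He & Ht & HQ). exists (S t), s'.
    split; [now apply exec_If_false|]. split; [lia|assumption].
Qed.

(** The index of the invariant bounds the number of iterations still to come, so the
    exact number need not be known beforehand. *)
Lemma runs_while b c (I : nat -> state -> Prop) (Q : state -> Prop) B :
  (forall n s, I n s -> test_sem b s -> exists m, n = S m /\ runs c s B (I m)) ->
  (forall n s, I n s -> ~ test_sem b s -> Q s) ->
  forall n s N, I n s -> (n * (B + 1) + 1 <= N)%nat -> runs (While b c) s N Q.
Proof.
  intros Hc Hq. induction n as [|n IH]; intros s N Hi HN;
    destruct (classic (test_sem b s)) as [H|H].
  2,4: exists 1%nat, s; split; [now constructor|]; split; [lia|]; eauto.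
  - destruct (Hc _ _ Hi H) as [m [E _]]. discriminate E.
  - destruct (Hc _ _ Hi H) as [m [E (t1 & s1 & H1 & Ht1 & Hi1)]].
    injection E as <-.
    destruct (IH s1 (n * (B + 1) + 1)%nat Hi1 (le_n _)) as (t2 & s2 & H2 & Ht2 & HQ).
    exists (S (t1 + t2)), s2. split; [now apply exec_While_true with s1|].
    split; [lia|assumption].
Qed.

Ltac simp :=
  cbn [set_reg set_mem set_idx reg mem idx upd Nat.eqb arith_sem arith_defined test_sem].
Ltac simp_in H :=
  cbn [set_reg set_mem set_idx reg mem idx upd Nat.eqb arith_sem arith_defined test_sem] in H.
Ltac step := eapply runs_seq_primitive; [constructor; simp; try exact Logic.I | lia | simp].
Ltac last_step := eapply runs_primitive; [constructor; simp; try exact Logic.I | lia | simp].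

Infix ";;" := Seq (at level 60, right associativity).

(** * Register layout *)

(** The numbering is hierarchical, so that a frame condition is a bound on the
    register number: registers below 10 are constant once the problem has been
    set up, those below 20 survive an evaluation of the sum, and those below 30
    survive the computation of a power. *)
Notation rRad := 0%nat (only parsing).
Notation rEps := 1%nat (only parsing).
Notation rZero := 2%nat (only parsing).
Notation rTwo := 3%nat (only parsing).
Notation rAmin := 4%nat (only parsing).
Notation rCmin := 5%nat (only parsing).
Notation rAmax := 6%nat (only parsing).
Notation rCmax := 7%nat (only parsing).
Notation rPivot := 8%nat (only parsing).
Notation rSpan := 9%nat (only parsing).

Notation rX := 10%nat (only parsing).
Notation rLow := 11%nat (only parsing).
Notation rTower := 12%nat (only parsing).
Notation rWidth := 13%nat (only parsing).
Notation rGap := 14%nat (only parsing).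
Notation rRatio := 15%nat (only parsing).
Notation rSign := 16%nat (only parsing).

Notation rVal := 20%nat (only parsing).
Notation rSlope := 21%nat (only parsing).
Notation rExp := 22%nat (only parsing).
Notation rCoef := 23%nat (only parsing).
Notation rDiff := 24%nat (only parsing).
Notation rTerm := 26%nat (only parsing).

Notation rPow := 30%nat (only parsing).
Notation rOne := 31%nat (only parsing).
Notation rBase := 32%nat (only parsing).
Notation rBound := 33%nat (only parsing).
Notation rBit := 34%nat (only parsing).
Notation rRest := 35%nat (only parsing).

(** [iPtr] and [iCount] belong to the loop over the terms; [iZero] is never
    written, so it keeps its initial value 0, like [rZero]. *)
Notation iLen := 0%nat (only parsing).
Notation iPtr := 1%nat (only parsing).
Notation iCount := 2%nat (only parsing).
Notation iZero := 3%nat (only parsing).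
Notation iSize := 4%nat (only parsing).
Notation iTop := 5%nat (only parsing).
Notation iLoop := 6%nat (only parsing).

(** * Loops *)

Definition flat (f : expsum) : list R := flat_map (fun t => [fst t; snd t]) f.

Lemma nth_flat done t rest d :
  nth (2 * length done) (flat (done ++ t :: rest)) d = fst t /\
  nth (S (2 * length done)) (flat (done ++ t :: rest)) d = snd t.
Proof.
  induction done as [|u done IH]; [easy|].
  cbn [length]. replace (2 * S (length done))%nat with (S (S (2 * length done))) by lia.
  exact IH.
Qed.

Definition holds (f : expsum) (s : state) : Prop :=
  idx s iLen = length f /\
  forall n, (n < 2 * length f)%nat -> mem s n = nth n (flat f) 0.

(** Leaves in [iPtr] the first address behind the input, where the table starts. *)
Definition foreach (body : cmd) : cmd :=
  IdxSet iPtr 0 ;; IdxSet iCount 0 ;;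
  While (IdxLt iCount iLen)
    (MemGet rExp iPtr ;; IdxIncr iPtr ;; MemGet rCoef iPtr ;; IdxIncr iPtr ;;
     IdxIncr iCount ;; body).

(** The invariant speaks of the processed prefix and of the real registers only; the
    body is verified for an arbitrary memory and arbitrary index registers, which it
    must leave alone. *)
Lemma runs_foreach f body B (I : expsum -> (nat -> R) -> Prop) s N :
  holds f s ->
  I [] (reg s) ->
  (forall done t rest r m ix, f = done ++ t :: rest -> I done r ->
     runs body (State (upd (upd r rExp (fst t)) rCoef (snd t)) m ix) B
       (fun s' => I (done ++ [t]) (reg s') /\ mem s' = m /\ idx s' = ix)) ->
  (length f * (B + 6) + 3 <= N)%nat ->
  runs (foreach body) s N
    (fun s' => I f (reg s') /\ mem s' = mem s /\ idx s' iPtr = (2 * length f)%nat /\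
               forall i, i <> iPtr -> i <> iCount -> idx s' i = idx s i).
Proof.
  intros [H0 Hm] HI Hbody HN. unfold foreach. step. step.
  apply runs_while with (B := (B + 5)%nat) (n := length f)
    (I := fun n s' => exists done rest, f = done ++ rest /\ length rest = n /\
       I done (reg s') /\ mem s' = mem s /\
       idx s' iPtr = (2 * length done)%nat /\ idx s' iCount = length done /\
       forall i, i <> iPtr -> i <> iCount -> idx s' i = idx s i).
  - intros n s1 (done & rest & Hf & Hl & Hi & Hmem & I1 & I2 & I3) Ht. simp_in Ht.
    rewrite I2, I3, H0, Hf, length_app in Ht by lia.
    destruct rest as [|t rest]; [simpl in Ht; lia|].
    destruct (nth_flat done t rest 0) as [N1 N2]. rewrite <- Hf in N1, N2.
    exists (length rest). split; [now simpl in Hl|].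
    assert (Hlen : length f = (length done + S (length rest))%nat)
      by (rewrite Hf, length_app; reflexivity).
    do 5 step. rewrite Hmem, I1, !Hm, N1, N2 by lia. unfold set_idx, set_reg. cbn [reg mem idx].
    eapply runs_weaken; [now apply (Hbody done t rest)|lia|].
    intros s2 (J1 & J2 & J3). exists (done ++ [t]), rest.
    split; [now rewrite <- app_assoc|]. split; [reflexivity|].
    rewrite J2, J3, length_app. simp. simpl (length [t]).
    repeat split; auto; try lia.
    intros i Hi1 Hi2. rewrite !upd_other by assumption. auto.
  - intros n s1 (done & rest & Hf & Hl & Hi & Hmem & I1 & I2 & I3) Ht. simp_in Ht.
    rewrite I2, I3, H0, Hf, length_app in Ht by lia.
    destruct rest as [|t rest]; [|simpl in Ht; lia].
    rewrite app_nil_r in Hf. subst done. auto.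
  - exists [], f. simp. repeat split; auto.
    intros i Hi1 Hi2. now rewrite !upd_other.
  - lia.
Qed.

Definition countdown (i : nat) (body : cmd) : cmd :=
  While (IdxLt iZero i) (IdxDecr i ;; body).

Lemma runs_countdown i body B (I : nat -> state -> Prop) n s N :
  (forall n s, I n s -> idx s iZero = 0%nat /\ idx s i = n) ->
  (forall n s, I (S n) s -> runs body (set_idx s i n) B (I n)) ->
  I n s -> (n * (B + 2) + 1 <= N)%nat ->
  runs (countdown i body) s N (I 0%nat).
Proof.
  intros Hidx Hbody HI HN.
  apply runs_while with (B := S B) (n := n) (I := I); [| |assumption|lia].
  - intros m s1 H1 Ht. simp_in Ht. destruct (Hidx _ _ H1) as [H2 H3].
    destruct m as [|m]; [lia|]. exists m. split; [reflexivity|]. step. rewrite H3.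
    eapply runs_weaken; [now apply Hbody|simpl; lia|auto].
  - intros m s1 H1 Ht. simp_in Ht. destruct (Hidx _ _ H1) as [H2 H3].
    replace 0%nat with m by lia. assumption.
Qed.

(** * Computing powers *)

(** The interface between the solver and the two ways of computing powers.  Only
    differences of exponents of [f] occur, so that for integer exponents
    [rDiff] is a natural number at most the degree. *)
Definition computes_powers (POW : cmd) (f : expsum) (K : nat) : Prop :=
  forall s t t', In t f -> In t' f -> fst t' <= fst t -> 0 < reg s rX ->
    reg s rDiff = fst t - fst t' ->
    runs POW s K (fun s' =>
      reg s' rPow = Rpower (reg s rX) (reg s rDiff) /\
      (forall r, (r < 30)%nat -> reg s' r = reg s r) /\
      mem s' = mem s /\ idx s' = idx s).

Definition oracle_pow : cmd := Pow rPow rX rDiff.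

Ltac below := repeat rewrite upd_other by lia.

Lemma oracle_pow_correct f : computes_powers oracle_pow f 1.
Proof.
  intros s t t' _ _ _ Hx _. last_step; [assumption|].
  repeat split; auto. intros r Hr. now below.
Qed.

(** Left-to-right binary powering.  The binary digits are extracted by comparing the
    exponent, a real number, with the powers of two in [rBit], since it cannot be
    moved to an index register. *)
Definition squaring_pow : cmd :=
  Const rOne 1 ;; Const rBase 2 ;; Arith Defs.Add rBound rDiff rOne ;; Const rBit 1 ;;
  While (RegLt rBit rBound) (Arith Defs.Add rBit rBit rBit) ;;
  Const rPow 1 ;; Arith Sub rRest rBound rOne ;;
  While (RegLt rOne rBit)
    (Arith Div rBit rBit rBase ;; Arith Mul rPow rPow rPow ;;
     If (RegLt rRest rBit) Skip (Arith Mul rPow rPow rX ;; Arith Sub rRest rRest rBit)).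

Lemma squaring_pow_correct f n :
  integral_exponents f ->
  (forall t t', In t f -> In t' f -> fst t - fst t' + 1 <= 2 ^ n) ->
  computes_powers squaring_pow f (9 + 9 * n).
Proof.
  intros Hint Hn s t t' Ht Ht' Hle Hx He. unfold integral_exponents in Hint.
  rewrite Forall_forall in Hint.
  set (x := reg s rX) in *. set (e := reg s rDiff) in *.
  assert (Hex : exists p : Z, e = IZR p /\ (0 <= p)%Z).
  { destruct (Hint (fst t)) as [p Hp]; [now apply in_map|].
    destruct (Hint (fst t')) as [p' Hp']; [now apply in_map|].
    exists (p - p')%Z. rewrite minus_IZR, <- Hp, <- Hp'. split; [assumption|].
    rewrite Hp, Hp' in Hle. apply le_IZR in Hle. lia. }
  destruct Hex as (p & Hp & Hp0).
  assert (Hen : e + 1 <= 2 ^ n) by (rewrite He; auto).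
  unfold squaring_pow. step. step. step. step. fold e.
  (* Doubling [rBit] until it exceeds the exponent. *)
  apply (runs_seq (2 * n + 1)); [|lia].
  apply runs_while with (B := 1%nat) (n := n) (I := fun m s' =>
    exists j, (j + m = n)%nat /\ reg s' rBit = 2 ^ j /\
    reg s' rOne = 1 /\ reg s' rBase = 2 /\ reg s' rBound = e + 1 /\
    (forall r, (r < 30)%nat -> reg s' r = reg s r) /\ mem s' = mem s /\ idx s' = idx s).
  { intros m s1 (j & Hj & R4 & R1 & R2 & R3 & Hr & Hm & Hi) Hlt. simp_in Hlt.
    rewrite R4, R3 in Hlt. destruct m as [|m].
    { replace j with n in Hlt by lia. lra. }
    exists m. split; [reflexivity|]. last_step.
    exists (S j). rewrite R4, R1, R2, R3. simpl (2 ^ S j). repeat split; auto; try lia; try lra.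
    intros r Hr0. below. auto. }
  2:{ exists 0%nat. simp. repeat split; auto.
      - intros r Hr0. now below. }
  2:{ lia. }
  intros m s1 (j & Hj & R4 & R1 & R2 & R3 & Hr & Hm & Hi) Hlt. simp_in Hlt.
  rewrite R4, R3 in Hlt. apply Rnot_lt_le in Hlt.
  step. step.
  (* With bit 2^j and rest q < 2^j, the accumulated power has the exponent
     (e - q) / 2^j, made of the leading digits of e. *)
  apply runs_while with (B := 6%nat) (n := j) (I := fun j s' =>
    exists q, (0 <= q)%Z /\ reg s' rRest = IZR q /\ IZR q + 1 <= 2 ^ j /\
    reg s' rBit = 2 ^ j /\ reg s' rPow = Rpower x ((e - IZR q) / 2 ^ j) /\
    reg s' rOne = 1 /\ reg s' rBase = 2 /\
    (forall r, (r < 30)%nat -> reg s' r = reg s r) /\ mem s' = mem s /\ idx s' = idx s).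
  - clear - Hx. intros j s1 (q & Hq & R5 & Hq1 & R4 & R0 & R1 & R2 & Hr & Hm & Hi) Ht.
    simp_in Ht. rewrite R1, R4 in Ht. destruct j as [|j]; [simpl in Ht; lra|].
    exists j. split; [reflexivity|].
    assert (H2j : 0 < 2 ^ j) by (apply pow_lt; lra).
    assert (Hhalf : 2 ^ S j / 2 = 2 ^ j) by (simpl; field).
    step; [rewrite R2; lra|]. step.
    rewrite R0, R2, R4, Hhalf, <- Rpower_plus.
    replace ((e - IZR q) / 2 ^ S j + (e - IZR q) / 2 ^ S j) with ((e - IZR q) / 2 ^ j)
      by (simpl; field; lra).
    apply runs_if; [lia| |]; intros Hc; simp_in Hc; rewrite R5 in Hc.
    + last_step. exists q.
      assert (IZR q + 1 <= 2 ^ j).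
      { rewrite pow_IZR in *. rewrite <- plus_IZR. apply IZR_le. apply lt_IZR in Hc. lia. }
      rewrite R1, R2, R5. repeat split; auto. intros r Hr0. below. auto.
    + apply Rnot_lt_le in Hc.
      step. last_step. rewrite (Hr rX) by lia. fold x.
      rewrite R1, R2, R5.
      rewrite pow_IZR in Hc.
      exists (q - Z.pow 2 (Z.of_nat j))%Z. rewrite minus_IZR, <- pow_IZR.
      apply le_IZR in Hc. repeat split; auto; try lia.
      * simpl in Hq1. lra.
      * rewrite <- (Rpower_1 x Hx) at 2. rewrite <- Rpower_plus. f_equal. field. lra.
      * intros r Hr0. below. auto.
  - intros m' s2 (q & Hq & R5' & Hq1 & R4' & R0' & R1' & R2' & Hr' & Hm' & Hi') Hlt'.
    simp_in Hlt'. rewrite R1', R4' in Hlt'.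
    destruct m' as [|m'].
    2:{ exfalso. apply Hlt'. apply Rlt_pow_R1; [lra|lia]. }
    assert (q = 0%Z).
    { simpl in Hq1. assert (H : IZR q <= IZR 0) by lra. apply le_IZR in H. lia. }
    subst q. split; [|auto]. rewrite R0'. f_equal. simpl. field.
  - exists p. simp. rewrite R1, R2, R3, R4, Hp in *. repeat split; auto; try lra.
    + replace ((IZR p - IZR p) / 2 ^ j) with 0.
      * unfold Rpower. now rewrite Rmult_0_l, exp_0.
      * unfold Rdiv, Rminus. rewrite Rplus_opp_r. ring.
    + intros r Hr0. below. auto.
  - lia.
Qed.

(** * The program *)

(** The machine has no move command; adding the register that holds 0 does the same. *)
Definition copy (r a : nat) : cmd := Arith Defs.Add r a rZero.

Definition find_extremes : cmd :=
  IdxSet iPtr 0 ;; MemGet rAmin iPtr ;; MemGet rAmax iPtr ;;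
  IdxIncr iPtr ;; MemGet rCmin iPtr ;; MemGet rCmax iPtr ;;
  foreach
    (If (RegLt rExp rAmin) (copy rAmin rExp ;; copy rCmin rCoef) Skip ;;
     If (RegLt rAmax rExp) (copy rAmax rExp ;; copy rCmax rCoef) Skip).

Lemma in_snoc {A} (P : A -> Prop) l a :
  (forall u, In u l -> P u) -> P a -> forall u, In u (l ++ [a]) -> P u.
Proof.
  intros Hl Ha u Hu. apply in_app_or in Hu. destruct Hu as [Hu|[<-|[]]]; auto.
Qed.

(* What remains in each of the four cases: the bounds over the extended prefix, and
   the registers below [rAmin]. *)
Local Ltac extend_range Hb :=
  repeat match goal with |- _ /\ _ => split end; auto; try ring;
  [ apply in_snoc; [intros v Hv; specialize (Hb v Hv); split; lra | split; lra]
  | intros i Hi; below; auto ].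

Lemma find_extremes_correct f s n :
  holds f s -> f <> [] -> reg s rZero = 0 -> (length f * 12 + 9 <= n)%nat ->
  runs find_extremes s n (fun s' =>
    (exists lo hi, In lo f /\ In hi f /\
      reg s' rAmin = fst lo /\ reg s' rCmin = snd lo /\
      reg s' rAmax = fst hi /\ reg s' rCmax = snd hi /\
      (forall t, In t f -> fst lo <= fst t <= fst hi) /\
      (forall r, (r < 4)%nat -> reg s' r = reg s r)) /\
    mem s' = mem s /\ (forall i, i <> iPtr -> i <> iCount -> idx s' i = idx s i)).
Proof.
  intros Hf Hne H2 Hn. destruct f as [|t0 f0]; [easy|]. set (f := t0 :: f0) in *.
  assert (Hin0 : In t0 f) by now left.
  assert (Hm := proj2 Hf). unfold find_extremes.
  do 6 step. rewrite !Hm by (simpl; lia). simpl nth.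
  eapply runs_weaken; [apply runs_foreach with (f := f) (B := 6%nat) (I := fun done r =>
    exists lo hi, In lo f /\ In hi f /\
      r rAmin = fst lo /\ r rCmin = snd lo /\ r rAmax = fst hi /\ r rCmax = snd hi /\
      (forall t, In t done -> fst lo <= fst t <= fst hi) /\
      (forall i, (i < 4)%nat -> r i = reg s i))| |].
  - destruct Hf as [Hf _]. split; simp; auto.
  - exists t0, t0. simp. repeat split; auto; try easy. intros i Hi. now below.
  - intros done t rest r m ix E (lo & hi & Hlo & Hhi & R4 & R5 & R6 & R7 & Hb & Hr).
    assert (Ht : In t f) by (rewrite E; apply in_elt).
    assert (R2 : r rZero = 0) by (rewrite Hr by lia; exact H2).
    apply (runs_seq 3); [|lia]. apply runs_if; [lia| |]; intros Hc; simp_in Hc; simp.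
    + rewrite R4 in Hc. step. last_step.
      apply runs_if; [lia| |]; intros Hc'; simp_in Hc'; simp; rewrite R6 in Hc'.
      * step. last_step. split; [|auto]. exists t, t. simp. rewrite R2.
        extend_range Hb.
      * last_step. split; [|auto]. exists t, hi. simp. rewrite R2.
        apply Rnot_lt_le in Hc'. extend_range Hb.
    + apply Rnot_lt_le in Hc. rewrite R4 in Hc. last_step.
      apply runs_if; [lia| |]; intros Hc'; simp_in Hc'; simp; rewrite R6 in Hc'.
      * step. last_step. split; [|auto]. exists lo, t. simp. rewrite R2.
        extend_range Hb.
      * last_step. split; [|auto]. exists lo, hi. simp.
        apply Rnot_lt_le in Hc'. extend_range Hb.
  - apply le_n.
  - lia.
  - intros s' (H & Hmem & _ & Hix). simp_in Hmem. split; [|split; [assumption|]].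
    + destruct H as (lo & hi & H). now exists lo, hi.
    + intros i H1' H2'. rewrite Hix by assumption. simp. now rewrite !upd_other.
Qed.

(** [rPivot] becomes the largest exponent of a coefficient whose sign is opposite to
    that of [rCmax], the sign found at the smallest exponent, where the search
    starts. *)
Definition find_pivot : cmd :=
  copy rPivot rAmin ;;
  foreach
    (Arith Mul rTerm rCoef rCmax ;;
     If (RegLt rTerm rZero) (If (RegLt rPivot rExp) (copy rPivot rExp) Skip) Skip).

Lemma find_pivot_correct f lo s n :
  holds f s -> reg s rZero = 0 -> In lo f -> reg s rAmin = fst lo ->
  snd lo * reg s rCmax < 0 -> (length f * 10 + 4 <= n)%nat ->
  runs find_pivot s n (fun s' =>
    ((exists t, In t f /\ reg s' rPivot = fst t /\ snd t * reg s rCmax < 0) /\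
     (forall t, In t f -> snd t * reg s rCmax < 0 -> fst t <= reg s' rPivot) /\
     (forall r, (r < 8)%nat -> reg s' r = reg s r)) /\
    mem s' = mem s /\ (forall i, i <> iPtr -> i <> iCount -> idx s' i = idx s i)).
Proof.
  intros Hf H2 Hlo H4 H7 Hn. unfold find_pivot. step.
  eapply runs_weaken; [apply runs_foreach with (f := f) (B := 4%nat) (I := fun done r =>
    (exists t, In t f /\ r rPivot = fst t /\ snd t * reg s rCmax < 0) /\
     (forall t, In t done -> snd t * reg s rCmax < 0 -> fst t <= r rPivot) /\
     (forall i, (i < 8)%nat -> r i = reg s i))| |].
  - destruct Hf as [? ?]. now split.
  - simp. repeat split; try easy.
    + exists lo. rewrite H2, H4. repeat split; auto. ring.
    + intros i Hi. now below.
  - intros done t rest r m ix E ((u & Hu & R8 & Hu7) & Hb & Hr).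
    assert (Ht : In t f) by (rewrite E; apply in_elt).
    assert (R2 : r rZero = 0) by (rewrite Hr by lia; exact H2).
    assert (R7 : r rCmax = reg s rCmax) by (rewrite Hr by lia; reflexivity).
    step. rewrite R7. apply runs_if; [lia| |]; intros Hc; simp_in Hc; rewrite R2 in Hc.
    + apply runs_if; [lia| |]; intros Hc'; simp_in Hc'.
      * last_step. rewrite R2. split; [|auto]. split; [|split].
        -- exists t. repeat split; auto. ring.
        -- intros v Hv Hv7. apply in_app_or in Hv. destruct Hv as [Hv|[<-|[]]]; [|lra].
           specialize (Hb v Hv Hv7). lra.
        -- intros i Hi. below. auto.
      * apply Rnot_lt_le in Hc'. last_step. split; [|auto]. split; [|split].
        -- now exists u.
        -- intros v Hv Hv7. apply in_app_or in Hv. destruct Hv as [Hv|[<-|[]]]; [|lra].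
           now apply Hb.
        -- intros i Hi. below. auto.
    + last_step. split; [|auto]. split; [|split].
      * now exists u.
      * intros v Hv Hv7. apply in_app_or in Hv. destruct Hv as [Hv|[<-|[]]]; [|lra].
        now apply Hb.
      * intros i Hi. below. auto.
  - apply le_n.
  - lia.
  - intros s' (H & Hmem & _ & Hix). auto.
Qed.

(** Shifting by the smallest exponent makes all exponents nonnegative; multiplying by
    the coefficient of the largest exponent makes the sum positive beyond its root.
    The program does both on the fly. *)
Definition normalize (lo hi : R * R) (f : expsum) : expsum :=
  map (fun t => (fst t - fst lo, snd t * snd hi)) f.

Lemma eval_normalize lo hi f x : 0 < x ->
  eval (normalize lo hi f) x = snd hi * Rpower x (- fst lo) * eval f x.
Proof.
  intros Hx. rewrite !eval_sum, <- sum_scal. unfold normalize. rewrite sum_map.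
  apply sum_ext. intros t _. simpl. unfold Rminus. rewrite Rpower_plus. ring.
Qed.

Definition evaluate (POW : cmd) : cmd :=
  Const rVal 0 ;; Const rSlope 0 ;;
  foreach
    (Arith Sub rDiff rExp rAmin ;; POW ;;
     Arith Mul rTerm rCoef rCmax ;; Arith Mul rTerm rTerm rPow ;;
     Arith Defs.Add rVal rVal rTerm ;;
     Arith Sub rDiff rExp rPivot ;; Arith Mul rTerm rTerm rDiff ;;
     Arith Defs.Add rSlope rSlope rTerm).

Definition make_table : cmd :=
  IdxCopy iTop iPtr ;; IdxSet iSize 0 ;; Const rTower 2 ;; Arith Div rRatio rRad rEps ;;
  While (RegLt rTower rRatio)
    (MemSet iTop rTower ;; IdxIncr iTop ;; IdxIncr iSize ;; Arith Mul rTower rTower rTower).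

Definition descend (POW : cmd) : cmd :=
  copy rLow rEps ;; IdxCopy iLoop iSize ;;
  countdown iLoop
    (IdxDecr iTop ;; MemGet rTower iTop ;; Arith Mul rX rLow rTower ;; evaluate POW ;;
     If (RegLt rVal rZero) (copy rLow rX) Skip).

Definition bisect (POW : cmd) : cmd :=
  copy rWidth rLow ;; Const rGap 40 ;; Arith Mul rGap rGap rSpan ;; Arith Mul rGap rGap rWidth ;;
  While (RegLt rLow rGap)
    (Arith Div rWidth rWidth rTwo ;; Arith Div rGap rGap rTwo ;; Arith Defs.Add rX rLow rWidth ;;
     evaluate POW ;; If (RegLt rVal rZero) (copy rLow rX) Skip).

Definition newton (POW : cmd) : cmd :=
  copy rX rLow ;; IdxCopy iLoop iSize ;;
  countdown iLoop
    (evaluate POW ;; Arith Div rVal rVal rSlope ;; Arith Mul rVal rX rVal ;; Arith Sub rX rX rVal).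

Definition locate (POW : cmd) : cmd :=
  copy rX rEps ;; evaluate POW ;;
  If (RegLt rVal rZero) (make_table ;; descend POW ;; bisect POW ;; newton POW) Skip ;;
  IdxSet iPtr 0 ;; MemSet iPtr rX ;; IdxSet iLen 1.

Definition solver (POW : cmd) : cmd :=
  find_extremes ;; Arith Mul rSign rCmin rCmax ;;
  If (RegLt rZero rSign) (IdxSet iLen 0)
    (find_pivot ;; Arith Sub rSpan rAmax rAmin ;;
     Const rOne 1 ;; Arith Defs.Add rSpan rSpan rOne ;; Const rTwo 2 ;;
     copy rX rRad ;; evaluate POW ;;
     If (RegLt rZero rVal) (locate POW) (IdxSet iLen 0)).

(** * Correctness of the phases *)

Section Phases.

Variables (POW : cmd) (f : expsum) (K : nat) (lo hi : R * R) (r0 : nat -> R).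
Hypothesis HPOW : computes_powers POW f K.
Hypothesis Hlo : In lo f.
Hypothesis Hrange : forall t, In t f -> fst lo <= fst t <= fst hi.
Hypothesis R2 : r0 rZero = 0.
Hypothesis R3 : r0 rTwo = 2.
Hypothesis R4 : r0 rAmin = fst lo.
Hypothesis R7 : r0 rCmax = snd hi.

Let k := length f.
Let rad := r0 rRad.
Let eps := r0 rEps.
Let D := r0 rSpan.
Let b := r0 rPivot - fst lo.
Let g := normalize lo hi f.
Let E := (k * (K + 13) + 5)%nat.

(** [r0] holds the values of the constant registers. *)
Definition ready (s : state) : Prop :=
  holds f s /\ idx s iZero = 0%nat /\ forall r, (r < 10)%nat -> reg s r = r0 r.

Lemma ready_preserved s s' :
  ready s -> (forall r, (r < 10)%nat -> reg s' r = reg s r) ->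
  (forall n, (n < 2 * k)%nat -> mem s' n = mem s n) ->
  idx s' iLen = idx s iLen -> idx s' iZero = idx s iZero -> ready s'.
Proof.
  intros ([H1 H2] & H3 & H4) Hr Hm H0 H3'. split; [split|split].
  - congruence.
  - intros n Hn. rewrite Hm by assumption. auto.
  - congruence.
  - intros r Hlt. rewrite Hr by assumption. auto.
Qed.

Lemma evaluate_correct s n :
  ready s -> 0 < reg s rX -> (E <= n)%nat ->
  runs (evaluate POW) s n (fun s' =>
    ready s' /\ reg s' rVal = eval g (reg s rX) /\
    reg s' rSlope = slope b g (reg s rX) /\
    (forall r, (r < 20)%nat -> reg s' r = reg s r) /\ mem s' = mem s /\
    idx s' iPtr = (2 * k)%nat /\ forall i, (3 <= i)%nat -> idx s' i = idx s i).
Proof.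
  intros Hs Hx Hn. assert (Hs' := Hs). destruct Hs as (Hf & H3 & Hr).
  set (x := reg s rX) in *. unfold evaluate. step. step.
  eapply runs_weaken; [apply runs_foreach with (f := f) (B := (K + 7)%nat) (I := fun done r =>
    r rVal = eval (normalize lo hi done) x /\
    r rSlope = slope b (normalize lo hi done) x /\
    forall i, (i < 20)%nat -> r i = reg s i)| |].
  - destruct Hf as [? ?]. now split.
  - simp. repeat split; auto. intros i Hi. now below.
  - intros done t rest r m ix Ef (S0 & S1 & Hi).
    assert (Ht : In t f) by (rewrite Ef; apply in_elt).
    step. apply (runs_seq K); [|lia].
    eapply runs_weaken; [apply (HPOW _ t lo); auto; simp|lia|].
    + now apply Hrange.
    + rewrite Hi by lia. exact Hx.
    + rewrite Hi, Hr, R4 by lia. reflexivity.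
    + intros s1 (P & Hr1 & Hm & Hix). simp_in P. simp_in Hm. simp_in Hix.
      do 5 step. last_step. split; [|auto].
      rewrite P, !Hr1 by lia. simp. rewrite (Hi rAmin), (Hi rCmax), (Hi rPivot), (Hi rX) by lia.
      fold x.
      rewrite (Hr rAmin), (Hr rCmax), (Hr rPivot), R4, R7 by lia.
      rewrite S0, S1. unfold normalize. rewrite !map_app.
      split; [|split].
      * rewrite !eval_sum, sum_app. unfold sum at 3. simpl. ring.
      * unfold slope. rewrite sum_app. unfold sum at 3. simpl. unfold b. ring.
      * intros i Hi'. below. rewrite Hr1 by lia. simp. below. auto.
  - apply le_n.
  - unfold E, k in Hn. lia.
  - intros s1 ((S0 & S1 & Hi) & Hm & H1 & Hix). simp_in Hm. simp_in Hix.
    split; [|repeat split; auto; intros; apply Hix; lia].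
    apply ready_preserved with s; auto.
    + intros; apply Hi; lia.
    + intros; congruence.
Qed.

Lemma make_table_correct s M n :
  ready s -> idx s iPtr = (2 * k)%nat -> rad / eps <= 2 ^ (2 ^ M) -> 0 < eps ->
  (5 * M + 5 <= n)%nat ->
  runs make_table s n (fun s' => ready s' /\ exists m, (m <= M)%nat /\
    idx s' iSize = m /\ idx s' iTop = (2 * k + m)%nat /\
    (forall i, (i < m)%nat -> mem s' (2 * k + i)%nat = 2 ^ (2 ^ i)) /\
    rad / eps <= 2 ^ (2 ^ m)).
Proof.
  intros Hs H1 HM He Hn. assert (Hr := proj2 (proj2 Hs)). unfold make_table.
  step. step. step. step.
  { rewrite Hr by lia. fold eps. lra. }
  apply runs_while with (B := 4%nat) (n := M) (I := fun n s' =>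
    ready s' /\ exists m, (m + n = M)%nat /\
    idx s' iSize = m /\ idx s' iTop = (2 * k + m)%nat /\
    reg s' rTower = 2 ^ (2 ^ m) /\ reg s' rRatio = rad / eps /\
    (forall i, (i < m)%nat -> mem s' (2 * k + i)%nat = 2 ^ (2 ^ i))).
  - intros j s1 (Hs1 & m & Hm & I4 & I5 & T & Q & Htab) Ht. simp_in Ht.
    rewrite T, Q in Ht. destruct j as [|j].
    { replace m with M in Ht by lia. lra. }
    exists j. split; [reflexivity|]. do 3 step. last_step.
    rewrite I4, I5, T, Q. split.
    + apply ready_preserved with s1; auto; simp.
      * intros r Hlt. now below.
      * intros i Hi. now below.
    + exists (S m). repeat split; try lia.
      * simpl (2 ^ S m)%nat. rewrite Nat.add_0_r, pow_add. reflexivity.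
      * intros i Hi. destruct (Nat.eq_dec i m) as [->|Hne].
        -- now rewrite upd_same.
        -- below. apply Htab. lia.
  - intros j s1 (Hs1 & m & Hm & I4 & I5 & T & Q & Htab) Ht. simp_in Ht.
    rewrite T, Q in Ht. apply Rnot_lt_le in Ht. split; [assumption|].
    exists m. repeat split; auto. lia.
  - split.
    + apply ready_preserved with s; auto; simp.
      intros r Hlt. now below.
    + exists 0%nat. simp. rewrite !Hr by lia. fold rad eps. rewrite H1.
      repeat split; try lia. simpl. ring.
  - lia.
Qed.

Variable z : R.
Hypothesis Hz : 0 < z.
Hypothesis Hroot : eval g z = 0.
Hypothesis Hsep : separated b g.
Hypothesis Hpos : exists t, In t g /\ 0 < snd t.

Lemma eval_neg_iff_below_root x : 0 < x -> (eval g x < 0 <-> x < z).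
Proof.
  intros Hx. split; intros H.
  - destruct (Rtotal_order x z) as [|[->|Hlt]]; [assumption|lra|].
    assert (0 < eval g x) by (apply (eval_sign_increases g b z); auto; lra). lra.
  - apply Rnot_le_lt. intros H0.
    assert (0 < eval g z) by (now apply (eval_sign_increases g b x)). lra.
Qed.

(** Since 2^(2^(n+1)) is the square of 2^(2^n), one comparison of z with lo 2^(2^n)
    halves the range of log2 (z / lo). *)
Lemma descend_correct s m n :
  ready s -> idx s iSize = m -> idx s iTop = (2 * k + m)%nat ->
  (forall i, (i < m)%nat -> mem s (2 * k + i)%nat = 2 ^ (2 ^ i)) ->
  0 < eps -> eps <= z -> z <= eps * 2 ^ (2 ^ m) ->
  (m * (E + 7) + 3 <= n)%nat ->
  runs (descend POW) s n (fun s' => ready s' /\ idx s' iSize = m /\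
    0 < reg s' rLow /\ reg s' rLow <= z <= 2 * reg s' rLow).
Proof.
  intros Hs I4 I5 Htab He H1 H2 Hn. unfold descend. assert (Hr := proj2 (proj2 Hs)).
  step. step. rewrite !Hr by lia. fold eps. rewrite R2, I4.
  eapply runs_weaken; [apply runs_countdown with (n := m) (B := (E + 5)%nat) (I := fun n s' =>
    ready s' /\ idx s' iSize = m /\ idx s' iTop = (2 * k + n)%nat /\ idx s' iLoop = n /\
    (forall i, (i < m)%nat -> mem s' (2 * k + i)%nat = 2 ^ (2 ^ i)) /\ (n <= m)%nat /\
    0 < reg s' rLow /\ reg s' rLow <= z <= reg s' rLow * 2 ^ (2 ^ n))| |].
  - intros j s1 (Hs1 & _ & _ & H & _). split; [apply Hs1|assumption].
  - intros j s1 (Hs1 & J4 & J5 & J6 & Jtab & Hj & L0 & L1 & L2).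
    do 3 step. rewrite J5. replace (pred (2 * k + S j)) with (2 * k + j)%nat by lia.
    rewrite Jtab by lia. set (l := reg s1 rLow) in *.
    assert (Hp : 0 < 2 ^ (2 ^ j)) by (apply pow_lt; lra).
    assert (Hl : 0 < l * 2 ^ (2 ^ j)) by (apply Rmult_lt_0_compat; lra).
    apply (runs_seq E); [|lia].
    eapply runs_weaken; [apply evaluate_correct; [|exact Hl|apply le_n]|lia|].
    { apply ready_preserved with s1; auto; simp. intros r Hlt. now below. }
    intros s2 (Hs2 & S0 & _ & Hr2 & Hm2 & _ & Hi2). simp_in S0. simp_in Hm2.
    assert (Hr2' := proj2 (proj2 Hs2)).
    assert (Hi4 : idx s2 iSize = m) by (rewrite Hi2 by lia; exact J4).
    assert (Hi5 : idx s2 iTop = (2 * k + j)%nat) by (rewrite Hi2 by lia; reflexivity).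
    assert (Hi6 : idx s2 iLoop = j) by (rewrite Hi2 by lia; reflexivity).
    apply runs_if; [lia| |]; intros Hc; simp_in Hc;
      rewrite S0, Hr2', R2 in Hc by lia; rewrite eval_neg_iff_below_root in Hc by exact Hl.
    + last_step. rewrite (Hr2' rZero), R2, (Hr2 rX) by lia. simp. split.
      { apply ready_preserved with s2; auto; simp. intros r Hlt. now below. }
      rewrite Hm2. repeat split; auto; try lia; try lra.
      simpl (2 ^ S j)%nat in L2. rewrite Nat.add_0_r, pow_add in L2. lra.
    + last_step. rewrite !Hr2 by lia. simp. fold l. rewrite Hm2.
      repeat split; auto; try lia; try lra; try apply Hs2.
  - split.
    { apply ready_preserved with s; auto; simp. intros r Hlt. now below. }
    simp. rewrite I5. repeat split; auto; lra.
  - apply le_n.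
  - lia.
  - intros s1 (Hs1 & J4 & J5 & J6 & Jtab & Hj & L0 & L1 & L2). simpl in L2.
    repeat split; auto; try apply Hs1; lra.
Qed.

Hypothesis HD : 1 <= D.

(** [rGap] holds 40 D times the width, so that the loop stops when the width is at
    most lo / (40 D); it halves in each iteration while lo never decreases, which
    bounds their number by log2 (40 D). *)
Lemma bisect_correct s m N n :
  ready s -> idx s iSize = m ->
  0 < reg s rLow -> reg s rLow <= z <= 2 * reg s rLow ->
  40 * D <= 2 ^ N -> (N * (E + 6) + 5 <= n)%nat ->
  runs (bisect POW) s n (fun s' => ready s' /\ idx s' iSize = m /\
    0 < reg s' rLow /\ 20 * D * Rabs (z / reg s' rLow - 1) <= 1 / 2).
Proof.
  intros Hs I4 H0 H1 HN Hn. unfold bisect. assert (Hr := proj2 (proj2 Hs)).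
  step. step. step. step. rewrite (Hr rZero), (Hr rSpan) by lia. fold D.
  rewrite R2, Rplus_0_r.
  set (l := reg s rLow) in *.
  apply runs_while with (n := N) (B := (E + 5)%nat) (I := fun n s' =>
    ready s' /\ idx s' iSize = m /\ 0 < reg s' rLow /\ 0 < reg s' rWidth /\
    reg s' rLow <= z <= reg s' rLow + reg s' rWidth /\
    reg s' rGap = 40 * D * reg s' rWidth /\ reg s' rGap <= 2 ^ n * reg s' rLow).
  - intros j s1 (Hs1 & J4 & L0 & W0 & [L1 L2] & V & VN) Ht. simp_in Ht.
    destruct j as [|j]; [simpl in VN; lra|]. exists j. split; [reflexivity|].
    assert (Hr1 := proj2 (proj2 Hs1)).
    step; [rewrite Hr1, R3 by lia; lra|]. step; [rewrite Hr1, R3 by lia; lra|]. step.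
    rewrite (Hr1 rTwo), R3 by lia.
    set (l1 := reg s1 rLow) in *. set (w := reg s1 rWidth) in *.
    assert (Hx : 0 < l1 + w / 2) by lra.
    apply (runs_seq E); [|lia].
    eapply runs_weaken; [apply evaluate_correct; [|exact Hx|apply le_n]|lia|].
    { apply ready_preserved with s1; auto; simp. intros r Hlt. now below. }
    intros s2 (Hs2 & S0 & _ & Hr2 & _ & _ & Hi2). simp_in S0.
    assert (Hr2' := proj2 (proj2 Hs2)).
    assert (Hi4 : idx s2 iSize = m) by (rewrite Hi2 by lia; exact J4).
    simpl (2 ^ S j) in VN. assert (Hp : 0 < 2 ^ j) by (apply pow_lt; lra).
    apply runs_if; [lia| |]; intros Hc; simp_in Hc;
      rewrite S0, Hr2', R2 in Hc by lia; rewrite eval_neg_iff_below_root in Hc by exact Hx.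
    + last_step. rewrite (Hr2' rZero), R2, !Hr2 by lia. simp. split.
      { apply ready_preserved with s2; auto; simp. intros r Hlt. now below. }
      repeat split; auto; try lra.
      apply Rle_trans with (2 ^ j * l1); [lra|]. apply Rmult_le_compat_l; lra.
    + last_step. rewrite !Hr2 by lia. simp. fold l1.
      repeat split; auto; try lra; try apply Hs2.
  - intros j s1 (Hs1 & J4 & L0 & W0 & [L1 L2] & V & VN) Ht. simp_in Ht.
    split; [assumption|]. split; [assumption|]. split; [assumption|].
    set (l1 := reg s1 rLow) in *. set (w := reg s1 rWidth) in *.
    replace (z / l1 - 1) with ((z - l1) / l1) by (field; lra).
    rewrite Rabs_right.
    2:{ apply Rle_ge. apply Rmult_le_pos; [lra|]. left. now apply Rinv_0_lt_compat. }
    apply (Rmult_le_reg_r l1); [assumption|].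
    replace (20 * D * ((z - l1) / l1) * l1) with (20 * (D * (z - l1))) by (field; lra).
    assert (D * (z - l1) <= D * w) by (apply Rmult_le_compat_l; lra). lra.
  - split.
    { apply ready_preserved with s; auto; simp. intros r Hlt. now below. }
    simp. fold l. repeat split; auto; try lra.
    apply Rmult_le_compat_r; lra.
  - lia.
Qed.

Hypothesis HDb : forall t, In t g -> Rabs (fst t - b) <= D.

(** With n steps left, the bound is 2^-(2^(m-n)); a step squares it. *)
Lemma newton_correct s m n :
  ready s -> idx s iSize = m ->
  0 < reg s rLow -> 20 * D * Rabs (z / reg s rLow - 1) <= 1 / 2 ->
  (m * (E + 5) + 3 <= n)%nat ->
  runs (newton POW) s n (fun s' =>
    0 < reg s' rX /\ 20 * D * Rabs (z / reg s' rX - 1) <= / 2 ^ (2 ^ m)).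
Proof.
  intros Hs I4 H0 H1 Hn. unfold newton. assert (Hr := proj2 (proj2 Hs)).
  step. step. rewrite (Hr rZero), R2, Rplus_0_r, I4 by lia.
  eapply runs_weaken; [apply runs_countdown with (n := m) (B := (E + 3)%nat) (I := fun n s' =>
    ready s' /\ idx s' iLoop = n /\ (n <= m)%nat /\ 0 < reg s' rX /\
    20 * D * Rabs (z / reg s' rX - 1) <= / 2 ^ (2 ^ (m - n)))| |].
  - intros j s1 (Hs1 & H & _). split; [apply Hs1|assumption].
  - intros j s1 (Hs1 & J6 & Hj & X0 & X1).
    set (x := reg s1 rX) in *.
    apply (runs_seq E); [|lia].
    eapply runs_weaken; [apply evaluate_correct; [|exact X0|apply le_n]|lia|].
    { apply ready_preserved with s1; auto. }
    intros s2 (Hs2 & S0 & S1 & Hr2 & _ & _ & Hi2). simp_in S0. simp_in S1. fold x in S0, S1.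
    set (q := 20 * D * Rabs (z / x - 1)) in *.
    assert (Hq0 : 0 <= q) by (apply Rmult_le_pos; [lra|apply Rabs_pos]).
    assert (Hpow : 2 <= 2 ^ (2 ^ (m - S j))).
    { rewrite <- (pow_1 2) at 1. apply Rle_pow; [lra|].
      change 1%nat with (2 ^ 0)%nat. apply Nat.pow_le_mono_r; lia. }
    assert (Hq : q <= 1 / 2).
    { eapply Rle_trans; [exact X1|]. unfold Rdiv. rewrite Rmult_1_l.
      apply Rinv_le_contravar; lra. }
    destruct (newton_step g b D x z) as (Hsl & Hx' & Hq'); auto.
    step; [rewrite S1; lra|]. step. last_step.
    rewrite S0, S1, !Hr2 by lia. simp. fold x. split.
    { apply ready_preserved with s2; auto; simp. intros r Hlt. now below. }
    split; [rewrite Hi2 by lia; reflexivity|]. split; [lia|]. split; [assumption|].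
    eapply Rle_trans; [exact Hq'|]. fold q.
    replace (m - j)%nat with (S (m - S j)) by lia.
    simpl (2 ^ S (m - S j))%nat. rewrite Nat.add_0_r, pow_add, Rinv_mult.
    simpl. rewrite Rmult_1_r. apply Rmult_le_compat; assumption.
  - split.
    { apply ready_preserved with s; auto; simp. intros r Hlt. now below. }
    simp. rewrite Nat.sub_diag. repeat split; auto. simpl. lra.
  - apply le_n.
  - lia.
  - intros s1 (Hs1 & J6 & Hj & X0 & X1). rewrite Nat.sub_0_r in X1. now split.
Qed.

Lemma locate_correct s M N n :
  ready s -> 0 < eps -> z < rad ->
  rad / eps <= 2 ^ (2 ^ M) -> 40 * D <= 2 ^ N ->
  ((1 + 2 * M + N) * (E + 7) + 5 * M + 30 <= n)%nat ->
  runs (locate POW) s n (fun s' => exists y, output s' = [y] /\ Rabs (y - z) <= eps).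
Proof.
  intros Hs He Hzr HM HN Hn. assert (Hr := proj2 (proj2 Hs)). unfold locate.
  step. rewrite !Hr by lia. fold eps. rewrite R2, Rplus_0_r.
  apply (runs_seq E); [|lia].
  eapply runs_weaken; [apply evaluate_correct; [|exact He|apply le_n]|lia|].
  { apply ready_preserved with s; auto; simp. intros r Hlt. now below. }
  intros s1 (Hs1 & S0 & _ & Hr1 & _ & I1 & _). simp_in S0. assert (Hr1' := proj2 (proj2 Hs1)).
  apply (runs_seq ((2 * M + N) * (E + 7) + 5 * M + 20)); [|lia].
  apply runs_weaken with (Q := fun s' => Rabs (reg s' rX - z) <= eps)
    (n := ((2 * M + N) * (E + 7) + 5 * M + 20)%nat); [|lia|].
  2:{ intros s2 H. step. step. last_step. exists (reg s2 rX). split; [|assumption].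
      reflexivity. }
  apply runs_if; [lia| |]; intros Hc; simp_in Hc;
    rewrite S0, Hr1', R2 in Hc by lia; rewrite eval_neg_iff_below_root in Hc by exact He.
  (* If z <= eps, then eps itself is close enough to z. *)
  2:{ last_step. rewrite Hr1 by lia. simp. rewrite Rabs_right; lra. }
  apply (runs_seq (5 * M + 5)); [|lia].
  eapply runs_weaken; [apply make_table_correct with (M := M); auto; try apply le_n|lia|].
  intros s2 (Hs2 & m & Hm & I4 & I5 & Htab & Hrm).
  assert (HmE : (m * (E + 7) <= M * (E + 7))%nat) by now apply Nat.mul_le_mono_r.
  apply (runs_seq (m * (E + 7) + 3)); [|lia].
  eapply runs_weaken; [apply descend_correct with (m := m); auto; try apply le_n; try lra|lia|].
  { apply Rle_trans with rad; [lra|]. apply (Rmult_le_compat_l eps) in Hrm; [|lra].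
    replace (eps * (rad / eps)) with rad in Hrm by (field; lra). exact Hrm. }
  intros s3 (Hs3 & J4 & L0 & L1).
  apply (runs_seq (N * (E + 6) + 5)); [|lia].
  eapply runs_weaken; [apply bisect_correct with (m := m) (N := N); auto; try apply le_n|lia|].
  intros s4 (Hs4 & K4 & X0 & X1).
  eapply runs_weaken; [apply newton_correct with (m := m); auto; try apply le_n|lia|].
  intros s5 (Y0 & Y1). set (x := reg s5 rX) in *.
  assert (HP : 0 < 2 ^ (2 ^ m)) by (apply pow_lt; lra).
  assert (HP1 : 1 <= 2 ^ (2 ^ m)) by (apply pow_R1_Rle; lra).
  set (q := Rabs (z / x - 1)) in *.
  assert (Hq : 20 * q <= / 2 ^ (2 ^ m)).
  { eapply Rle_trans; [|exact Y1]. assert (0 <= q) by apply Rabs_pos. nra. }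
  assert (Hinv : / 2 ^ (2 ^ m) <= 1) by (rewrite <- Rinv_1; apply Rinv_le_contravar; lra).
  assert (Hqx := Rabs_le_inv _ _ (Rle_refl q)). unfold q at 1 in Hqx.
  assert (Hzx : z = x * (z / x)) by (field; lra).
  assert (Hq2 := Rabs_le_inv _ _ (Rle_refl (Rabs (z / x - 1)))). fold q in Hq2.
  (* The absolute error is x q, with x <= 2 z < 2 rad. *)
  assert (Hxz : x <= 2 * z) by nra.
  replace (x - z) with (- (x * (z / x - 1))) by (field; lra).
  rewrite Rabs_Ropp, Rabs_mult, (Rabs_right x) by lra. fold q.
  assert (HrE : rad * / 2 ^ (2 ^ m) <= eps).
  { apply (Rmult_le_reg_r (2 ^ (2 ^ m))); [assumption|].
    rewrite Rmult_assoc, Rinv_l, Rmult_1_r by lra.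
    apply (Rmult_le_compat_l eps) in Hrm; [|lra].
    replace (eps * (rad / eps)) with rad in Hrm by (field; lra). exact Hrm. }
  apply Rle_trans with (2 * rad * (/ 2 ^ (2 ^ m) / 20)); [|nra].
  apply Rmult_le_compat; try lra.
Qed.

End Phases.

(** * Correctness and cost *)

Lemma no_roots_approximated f rad eps s :
  (forall x, 0 < x < rad -> eval f x <> 0) -> idx s iLen = 0%nat ->
  approximates_roots f rad eps (output s).
Proof.
  intros H H0. exists []. unfold output. rewrite H0. split; [constructor|].
  split; [|constructor]. intros x. split; [easy|]. intros [Hx Hx0]. now apply (H x).
Qed.

(** M bounds the size of the table, and with it the number of Newton steps; N bounds
    the number of bisections. *)
Lemma solver_runs POW f K rad eps M N :
  is_expsum f -> (sign_alternations f <= 1)%nat -> 0 < rad -> 0 < eps ->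
  computes_powers POW f K -> (1 <= K)%nat -> rad / eps <= 2 ^ (2 ^ M) ->
  (forall t t', In t f -> In t' f -> fst t' < fst t -> 40 * (fst t - fst t' + 1) <= 2 ^ N) ->
  runs (solver POW) (input f rad eps) (200 * (length f * K * (1 + M + N)))
    (fun s => approximates_roots f rad eps (output s)).
Proof.
  intros Hf Halt Hrad Heps HPOW HK HM HN.
  assert (Hne : f <> []) by apply Hf.
  assert (Hin : holds f (input f rad eps)) by (split; auto).
  assert (Hk : (1 <= length f)%nat) by (destruct f; [easy|simpl; lia]).
  set (k := length f) in *.
  assert (HkK : (k <= k * K)%nat) by nia.
  assert (HkKM : (k * K <= k * K * (1 + M + N))%nat) by nia.
  assert (HMkK : (M <= k * K * M)%nat) by nia.
  unfold solver. apply (runs_seq (k * 12 + 9)); [|lia].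
  eapply runs_weaken; [apply (find_extremes_correct f); auto; apply le_n|apply le_n|].
  intros s1 ((lo & hi & Hlo & Hhi & A4 & A5 & A6 & A7 & Hrange & Ar) & Am & Ai).
  step. rewrite A5, A7. unfold input in Ar, Am, Ai. cbn [reg mem idx] in Ar, Am, Ai.
  apply runs_if; [lia| |]; intros Hc; simp_in Hc; rewrite (Ar rZero) in Hc by lia;
    simpl nth in Hc.
  (* The extreme coefficients agree in sign, hence so do all of them. *)
  { last_step. apply no_roots_approximated; [|reflexivity]. intros x _.
    apply eval_same_sign with (snd hi); [assumption|]. intros t Ht.
    now apply (same_sign_constant f lo). }
  assert (Hlh : snd lo * snd hi < 0).
  { assert (H1 := coefficient_neq_0 f Hf lo Hlo). assert (H2 := coefficient_neq_0 f Hf hi Hhi).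
    apply Rnot_lt_le in Hc. destruct Hc as [Hc|Hc]; [assumption|].
    apply Rmult_integral in Hc. tauto. }
  assert (Hlt : fst lo < fst hi).
  { apply (exponent_lt f); auto. now apply Hrange. }
  specialize (HN hi lo Hhi Hlo Hlt).
  assert (HN0 : (1 <= N)%nat).
  { destruct N; [simpl in HN; lra|lia]. }
  apply (runs_seq (k * 10 + 4)); [|lia].
  assert (Hh1 : holds f s1).
  { split; [rewrite Ai by easy; reflexivity|]. rewrite Am. auto. }
  assert (Hz1 : reg s1 rZero = 0) by (rewrite Ar by lia; reflexivity).
  rewrite <- A7 in Hlh.
  eapply runs_weaken; [now apply (find_pivot_correct f lo); try apply le_n|apply le_n|].
  rewrite A7 in Hlh. clear Hz1.
  simp. rewrite A7. intros s2 (((u & Hu & B8 & Bu) & Bmax & Br) & Bm & Bi).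
  do 5 step.
  rewrite !Br by lia. simp. rewrite A4, A6, (Ar rRad), (Ar rZero), Rplus_0_r by lia.
  simpl nth.
  match goal with |- runs _ ?s _ _ => set (s3 := s) end.
  assert (Hready : ready f (reg s3) s3).
  { split; [split|split]; auto; unfold s3; simp.
    - rewrite Bi, Ai by easy. reflexivity.
    - rewrite Bm, Am. auto.
    - rewrite Bi, Ai by easy. reflexivity. }
  set (g := normalize lo hi f). set (b := fst u - fst lo).
  assert (Hsep : separated b g).
  { intros t Ht. apply in_map_iff in Ht. destruct Ht as [v [<- Hv]]. simpl. unfold b.
    assert (H1 := coefficient_neq_0 f Hf v Hv). assert (H2 := coefficient_neq_0 f Hf hi Hhi).
    destruct (Rtotal_order (snd v * snd hi) 0) as [H|[H|H]].
    - left. split; [assumption|]. specialize (Bmax v Hv H). rewrite B8 in Bmax. lra.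
    - apply Rmult_integral in H. tauto.
    - right. split; [assumption|].
      assert (fst u < fst v) by now apply (signs_separated f lo hi). lra. }
  assert (Hb : reg s3 rPivot - fst lo = b) by (unfold s3; simp; now rewrite B8).
  assert (Hpos : exists t, In t g /\ 0 < snd t).
  { exists (fst hi - fst lo, snd hi * snd hi). split.
    - apply (in_map (fun t => (fst t - fst lo, snd t * snd hi))). assumption.
    - simpl. assert (H2 := coefficient_neq_0 f Hf hi Hhi). nra. }
  assert (Hnegt : exists t, In t g /\ snd t < 0).
  { exists (fst lo - fst lo, snd lo * snd hi). split; [|exact Hlh].
    apply (in_map (fun t => (fst t - fst lo, snd t * snd hi))). assumption. }
  assert (Hhi0 := coefficient_neq_0 f Hf hi Hhi).
  assert (Hiff : forall x, 0 < x -> (eval f x = 0 <-> eval g x = 0)).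
  { intros x Hx. unfold g. rewrite eval_normalize by assumption.
    assert (HP := Rpower_pos x (- fst lo)). split; intros H.
    - rewrite H. ring.
    - apply Rmult_integral in H. destruct H as [H|H]; [|assumption].
      apply Rmult_integral in H. destruct H; [tauto|lra]. }
  assert (S0 : reg s3 rRad = rad).
  { unfold s3. simp. rewrite Br by lia. simp. rewrite Ar by lia. reflexivity. }
  assert (S1 : reg s3 rEps = eps).
  { unfold s3. simp. rewrite Br by lia. simp. rewrite Ar by lia. reflexivity. }
  assert (S2 : reg s3 rZero = 0).
  { unfold s3. simp. rewrite Br by lia. simp. rewrite Ar by lia. reflexivity. }
  assert (S3 : reg s3 rTwo = 2) by reflexivity.
  assert (S4 : reg s3 rAmin = fst lo).
  { unfold s3. simp. rewrite Br by lia. exact A4. }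
  assert (S7 : reg s3 rCmax = snd hi).
  { unfold s3. simp. rewrite Br by lia. exact A7. }
  assert (S9 : reg s3 rSpan = fst hi - fst lo + 1) by reflexivity.
  assert (S10 : reg s3 rX = rad) by reflexivity.
  clearbody s3.
  apply (runs_seq (k * (K + 13) + 5)); [|lia].
  eapply runs_weaken.
  { apply (evaluate_correct POW f K lo hi (reg s3)); auto; try apply le_n. now rewrite S10. }
  { apply le_n. }
  rewrite S10. fold g.
  intros s4 (Hs4 & E0 & _ & Hr4 & _ & _ & Hi4).
  apply runs_if; [lia| |]; intros Hc'; simp_in Hc'; rewrite E0, (Hr4 rZero), S2 in Hc' by lia.
  (* If g(rad) <= 0, then g < 0 on the whole of (0, rad). *)
  2:{ last_step. apply no_roots_approximated; [|reflexivity].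
      intros x Hx Hx0. rewrite Hiff in Hx0 by lra. apply Hc'.
      apply (eval_sign_increases g b x); auto; lra. }
  destruct (eval_neg_near_zero g b Hsep Hnegt) as (del & Hdel & Hneg).
  set (x0 := Rmin del rad / 2).
  assert (Hx0 : 0 < Rmin del rad) by (apply Rmin_glb_lt; lra).
  assert (Hx1 := Rmin_l del rad). assert (Hx2 := Rmin_r del rad).
  destruct (root_between g x0 rad) as (z & Hz & Hz0).
  { unfold x0; lra. }
  { unfold x0; lra. }
  { apply Hneg; unfold x0; lra. }
  { assumption. }
  assert (Hz1 : 0 < z < rad) by (unfold x0 in Hz; lra).
  eapply runs_weaken;
    [apply (locate_correct POW f K lo hi (reg s3)) with (z := z) (M := M) (N := N);
    rewrite ?Hb, ?S0, ?S1, ?S9; auto; try lra; try apply le_n| |].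
  - intros t Ht. apply in_map_iff in Ht. destruct Ht as [v [<- Hv]]. simpl. unfold b.
    assert (H1 := Hrange v Hv). assert (H2 := Hrange u Hu). apply Rabs_le. lra.
  - fold k. nia.
  - intros s' (y & Ho & Hy). rewrite S1 in Hy. rewrite Ho. exists [z]. split; [|split].
    + constructor; [easy|constructor].
    + intros x. simpl. split.
      * intros [<-|[]]. split; [lra|]. apply Hiff; [lra|assumption].
      * intros [Hx Hx'']. left. apply Hiff in Hx''; [|lra].
        destruct (Rtotal_order x z) as [H|[H|H]]; [|now symmetry|].
        -- assert (0 < eval g z) by (apply (eval_sign_increases g b x); auto; lra). lra.
        -- assert (0 < eval g x) by (apply (eval_sign_increases g b z); auto; lra). lra.
    + constructor; [assumption|constructor].
Qed.

(** For a single term there is no bisection to account for; otherwise the degree is at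
    least 1 and 40 D <= 2^7 d. *)
Lemma solver_correct POW f K rad eps :
  is_expsum f -> (sign_alternations f <= 1)%nat -> 0 < rad -> 0 < eps ->
  computes_powers POW f K -> (1 <= K)%nat ->
  solves_in (solver POW) f rad eps
    (4000 * INR K * (INR (length f) * (lg (degree f) + lg (lg (rad / eps))))).
Proof.
  intros Hf Halt Hrad Heps HPOW HK.
  destruct (exists_pow2_pow2_ge (rad / eps)) as (M & HM & HMI).
  assert (HN : exists N, INR N <= 17 * lg (degree f) /\
    forall t t', In t f -> In t' f -> fst t' < fst t -> 40 * (fst t - fst t' + 1) <= 2 ^ N).
  { destruct (classic (exists t t', In t f /\ In t' f /\ fst t' < fst t))
      as [(t & t' & Ht & Ht' & Hlt)|Hno].
    - destruct (exists_pow2_ge (2 ^ 7 * degree f)) as (N & HN & HNI). exists N.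
      assert (Hd := proj2 (degree_ge_diff f t' t Ht' Ht Hlt)).
      assert (H := lg_pow2_mult 7 (degree f) (2 ^ 7 * degree f)
        ltac:(simpl; lra) ltac:(lra) ltac:(lra)).
      assert (H1 := lg_ge_1 (degree f)). split.
      + replace (INR 7) with 7 in H by (simpl; lra). lra.
      + intros v v' Hv Hv' Hlt'. destruct (degree_ge_diff f v' v Hv' Hv Hlt') as [Hd' _].
        eapply Rle_trans; [|exact HN]. simpl. lra.
    - exists 0%nat. split.
      + assert (H1 := lg_ge_1 (degree f)). simpl. lra.
      + intros t t' Ht Ht' Hlt. exfalso. apply Hno. now exists t, t'. }
  destruct HN as (N & HNI & HN).
  destruct (solver_runs POW f K rad eps M N) as (t & s & He & Ht & Ha); auto.
  exists t, s. split; [assumption|]. split; [assumption|].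
  apply le_INR in Ht. eapply Rle_trans; [exact Ht|].
  rewrite !mult_INR, !plus_INR. replace (INR 200) with 200 by (simpl; lra).
  simpl (INR 1). assert (H1 := lg_ge_1 (degree f)). assert (H2 := lg_ge_1 (lg (rad / eps))).
  assert (Hk := pos_INR (length f)). assert (HK0 := pos_INR K).
  replace (4000 * INR K * (INR (length f) * (lg (degree f) + lg (lg (rad / eps)))))
    with (200 * (INR (length f) * INR K * (20 * (lg (degree f) + lg (lg (rad / eps)))))) by ring.
  apply Rmult_le_compat_l; [lra|]. apply Rmult_le_compat_l; [|lra].
  now apply Rmult_le_pos.
Qed.

Theorem theorem2 :
  (exists (P : cmd) (C : R),
     forall (f : expsum) (rad eps : R),
       is_expsum f -> (sign_alternations f <= 1)%nat -> 0 < rad -> 0 < eps ->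
       solves_in P f rad eps
         (C * (INR (length f) * (lg (degree f) + lg (lg (rad / eps))))))
  /\
  (exists (P : cmd) (C : R),
     oracle_free P /\
     forall (f : expsum) (rad eps : R),
       is_expsum f -> integral_exponents f ->
       (sign_alternations f <= 1)%nat -> 0 < rad -> 0 < eps ->
       solves_in P f rad eps
         (C * (INR (length f) * lg (degree f)
               * (lg (degree f) + lg (lg (rad / eps)))))).
Proof.
  split.
  - exists (solver oracle_pow), (4000 * INR 1). intros f rad eps Hf Halt Hrad Heps.
    apply solver_correct; auto. apply oracle_pow_correct.
  - exists (solver squaring_pow), (4000 * 54). split; [simpl; tauto|].
    intros f rad eps Hf Hint Halt Hrad Heps.
    assert (Hdeg : degree f = max_diff f).
    { unfold degree. now destruct excluded_middle_informative. }
    (* The degree of a monomial is 0, hence the maximum. *)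
    set (d := Rmax 1 (degree f)).
    assert (Hd1 : 1 <= d) by apply Rmax_l.
    destruct (exists_pow2_ge (2 ^ 1 * d)) as (n & Hn & HnI).
    assert (Hl := lg_pow2_mult 1 d (2 ^ 1 * d) ltac:(simpl; lra) ltac:(lra) ltac:(lra)).
    assert (Hld : lg d = lg (degree f)) by apply lg_Rmax_1. rewrite Hld in Hl.
    destruct (solver_correct squaring_pow f (9 + 9 * n) rad eps) as (t & s & He & Ha & Ht); auto.
    + apply squaring_pow_correct; [assumption|]. intros u u' Hu Hu'.
      eapply Rle_trans; [|exact Hn].
      assert (fst u - fst u' <= degree f).
      { rewrite Hdeg. apply le_fold_Rmax.
        apply (in_map (fun p => fst p - snd p) _ (fst u, fst u')).
        apply in_prod; now apply in_map. }
      assert (degree f <= d) by apply Rmax_r. simpl. lra.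
    + lia.
    + exists t, s. split; [assumption|]. split; [assumption|].
      eapply Rle_trans; [exact Ht|].
      assert (H1 := lg_ge_1 (degree f)). assert (H2 := lg_ge_1 (lg (rad / eps))).
      assert (HK : INR (9 + 9 * n) <= 54 * lg (degree f)).
      { rewrite plus_INR, mult_INR. replace (INR 9) with 9 by (simpl; lra).
        simpl (INR 1) in Hl. lra. }
      apply Rle_trans with (4000 * (54 * lg (degree f)) *
        (INR (length f) * (lg (degree f) + lg (lg (rad / eps))))); [|right; ring].
      apply Rmult_le_compat_r; [|lra].
      apply Rmult_le_pos; [apply pos_INR|lra].
Qed.
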